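(* Let $q$ be a prime power, and let $M(\mathbb{F}_q)$ be the metric $\mathbb{F}_q$-algebra associated with a factor sequence $n_0,n_1,\dots$. Then the topological group $\mathrm{Aut}(M(\mathbb{F}_q))$ is extremely amenable.
   Context: Each matrix algebra $M_n(\mathbb{F}_q)$, $n\ge 1$, carries the metric $d(x,y)=\frac{\mathrm{rank}(x-y)}{n}$. For $m\mid n$, $\iota_{n,m}:M_m(\mathbb{F}_q)\to M_n(\mathbb{F}_q)$ is the isometric unital embedding $x\mapsto x\otimes 1_{n/m}$. A factor sequence is a sequence $n_0,n_1,\dots$ of positive integers with $n_k\mid n_{k+1}$ for all $k$ and $n_k\to\infty$. $M(\mathbb{F}_q)$ is the metric completion of the direct limit (with the induced metric) of $M_{n_0}(\mathbb{F}_q)\to M_{n_1}(\mathbb{F}_q)\to\cdots$ along the maps $\iota_{n_{k+1},n_k}$; it is a unital $\mathbb{F}_q$-algebra. $\mathrm{Aut}(M(\mathbb{F}_q))$ is the group of isometric unital $\mathbb{F}_q$-algebra automorphisms of $M(\mathbb{F}_q)$ with the topology of pointwise convergence, in which basic neighborhoods of $\phi$ are the sets $\{f: d(f(x),\phi(x))<\varepsilon \text{ for all } x\in X\}$ for $X\subset M(\mathbb{F}_q)$ finite and $\varepsilon>0$. A topological group $G$ is extremely amenable if every continuous action of $G$ on a nonempty compact Hausdorff space has a fixed point. *)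

(* Defs.v *)
From HB Require Import structures.
From mathcomp Require Import all_boot all_order all_algebra generic_quotient.
From mathcomp Require Import mxtens.
From mathcomp Require Import all_classical all_reals topology normedtype sequences.
From mathcomp Require Import interval_inference lra.
Set Implicit Arguments.
Unset Strict Implicit.
Unset Printing Implicit Defensive.
Import Order.TTheory GRing.Theory Num.Theory.
Import numFieldNormedType.Exports.
Local Open Scope classical_set_scope.
Local Open Scope quotient_scope.
Local Open Scope ring_scope.

Section CauchySeq.
Context {R : realType} (T : metricType R).

Record cauchy_seq := CauchySeq {
  cauchy_seq_val :> nat -> T;
  _ : `[< cauchy (cauchy_seq_val @ \oo) >]
}.
HB.instance Definition _ := [isSub for cauchy_seq_val].
HB.instance Definition _ := gen_eqMixin cauchy_seq.
HB.instance Definition _ := gen_choiceMixin cauchy_seq.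

Lemma cauchy_seqE (u : nat -> T) : cauchy (u @ \oo) <->
  forall e : R, 0 < e -> exists N, forall i j, (N <= i)%N -> (N <= j)%N ->
    mdist (u i) (u j) < e.
Proof.
split.
  move=> /cauchyP cu e e0.
  have [x [N _ xN]] := cu (e / 2) (divr_gt0 e0 (ltr0n _ 2)).
  exists N => i j Ni Nj.
  have := xN i Ni; have := xN j Nj; rewrite ballEmdist /= => xj xi.
  rewrite (le_lt_trans (metric_triangle _ x _))// (splitr e) ltrD//.
  by rewrite metric_sym.
move=> cu; apply/cauchy_ballP => e e0.
have [N uN] := cu e e0.
exists ([set u i | i in [set i | (N <= i)%N]], [set u i | i in [set i | (N <= i)%N]]).
  by split; exists N => //= i Ni; exists i.
by move=> [_ _] /= [[i Ni <-] [j Nj <-]]; rewrite ballEmdist; exact: uN.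
Qed.

Lemma cauchy_seqP (u : cauchy_seq) (e : R) : 0 < e -> exists N, forall i j,
  (N <= i)%N -> (N <= j)%N -> mdist (u i) (u j) < e.
Proof. by case: u => u /= /asboolP /cauchy_seqE; apply. Qed.

Definition mk_cauchy_seq (u : nat -> T) (cu : cauchy (u @ \oo)) : cauchy_seq :=
  CauchySeq (asboolT cu).

Lemma mdist_lip (x y x' y' : T) :
  `|mdist x y - mdist x' y'| <= mdist x x' + mdist y y'.
Proof.
have h1 := metric_triangle x x' y; have h2 := metric_triangle x' y' y.
have h3 := metric_triangle x' x y'; have h4 := metric_triangle x y y'.
have h5 := metric_sym x x'; have h6 := metric_sym y y'.
rewrite ler_norml; apply/andP; split; lra.
Qed.

Lemma is_cvg_mdist (u v : cauchy_seq) : cvgn (fun k => mdist (u k) (v k)).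
Proof.
apply/cauchy_cvgP/cauchy_ballP => e e0.
have e2 : 0 < e / 2 by rewrite divr_gt0.
have [N uN] := cauchy_seqP u e2; have [N' vN] := cauchy_seqP v e2.
pose w k := mdist (u k) (v k).
pose A := [set w i | i in [set i | (maxn N N' <= i)%N]].
exists (A, A); first by split; exists (maxn N N') => //= i Ni; exists i.
move=> [_ _] /= [[i + <-] [j + <-]]; rewrite /= !geq_max.
move=> /andP[Ni Ni'] /andP[Nj Nj']; rewrite /ball /=.
rewrite (le_lt_trans (mdist_lip _ _ _ _))// (splitr e) ltrD//.
- exact: uN.
- exact: vN.
Qed.

(* Two Cauchy sequences are identified when their distance tends to 0. *)
Definition cauchy_equiv (u v : cauchy_seq) :=
  `[< mdist (u k) (v k) @[k --> \oo] --> (0 : R) >].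

Lemma cauchy_equiv_refl : reflexive cauchy_equiv.
Proof.
move=> u; apply/asboolP; under eq_fun do rewrite mdistxx; exact: cvg_cst.
Qed.

Lemma cauchy_equiv_sym : symmetric cauchy_equiv.
Proof.
by move=> u v; rewrite /cauchy_equiv; under eq_fun do rewrite metric_sym.
Qed.

Lemma cauchy_equiv_trans : transitive cauchy_equiv.
Proof.
move=> v u w /asboolP uv /asboolP vw; apply/asboolP.
apply: (@squeeze_cvgr _ _ _ _ (fun=> 0)
  (fun k => mdist (u k) (v k) + mdist (v k) (w k))).
- by apply: nearW => k; rewrite mdist_ge0 metric_triangle.
- exact: cvg_cst.
- by rewrite -[X in _ --> X]addr0; exact: cvgD.
Qed.

Canonical cauchy_equiv_rel :=
  EquivRel cauchy_equiv cauchy_equiv_refl cauchy_equiv_sym cauchy_equiv_trans.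

Definition completion := {eq_quot cauchy_equiv}%qT.

HB.instance Definition _ := Choice.on completion.
HB.instance Definition _ := EqQuotient.on completion.

Definition cauchy_lim (u : cauchy_seq) : completion := \pi_completion u.

Lemma cauchy_limK (x : completion) : cauchy_lim (repr x) = x.
Proof. exact: reprK. Qed.

Lemma cauchy_limW (P : completion -> Prop) :
  (forall u, P (cauchy_lim u)) -> forall x, P x.
Proof. by move=> Pu x; rewrite -[x]cauchy_limK. Qed.

Lemma completionP (u v : cauchy_seq) :
  cauchy_lim u = cauchy_lim v <->
  mdist (u k) (v k) @[k --> \oo] --> (0 : R).
Proof.
split=> [/eqmodP/asboolP//|uv].
by apply/eqmodP/asboolP.
Qed.

(* The distance does not depend on the choice of representatives:
   [completion_mdistE] *)
Definition completion_mdist (x y : completion) : R :=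
  limn (fun k => mdist (repr x k) (repr y k)).

Lemma cvg_completion_mdist (u v : cauchy_seq) :
  mdist (u k) (v k) @[k --> \oo] -->
  completion_mdist (cauchy_lim u) (cauchy_lim v).
Proof.
set u' := repr (cauchy_lim u); set v' := repr (cauchy_lim v).
have uu' : mdist (u k) (u' k) @[k --> \oo] --> (0 : R).
  by apply/completionP; rewrite cauchy_limK.
have vv' : mdist (v k) (v' k) @[k --> \oo] --> (0 : R).
  by apply/completionP; rewrite cauchy_limK.
have d0 : (mdist (u k) (v k) - mdist (u' k) (v' k)) @[k --> \oo] --> (0 : R).
  apply/norm_cvg0P; apply: (@squeeze_cvgr _ _ _ _ (fun=> 0)
    (fun k => mdist (u k) (u' k) + mdist (v k) (v' k))).
  - by apply: nearW => k; rewrite /= normr_ge0 mdist_lip.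
  - exact: cvg_cst.
  - by rewrite -[X in _ --> X]addr0; exact: cvgD.
have c' : mdist (u' k) (v' k) @[k --> \oo] -->
    completion_mdist (cauchy_lim u) (cauchy_lim v).
  exact: (@is_cvg_mdist u' v').

have -> : (fun k => mdist (u k) (v k)) = (fun k =>
    mdist (u k) (v k) - mdist (u' k) (v' k) + mdist (u' k) (v' k)).
  by apply/funext => k; rewrite subrK.
by rewrite -[X in _ --> X]add0r; exact: cvgD d0 c'.
Qed.

Lemma completion_mdistE (u v : cauchy_seq) :
  completion_mdist (cauchy_lim u) (cauchy_lim v) =
  limn (fun k => mdist (u k) (v k)).
Proof. by apply/esym/cvg_lim => //; exact: cvg_completion_mdist. Qed.

Lemma completion_mdistxx x : completion_mdist x x = 0.
Proof.
by rewrite /completion_mdist; under eq_fun do rewrite mdistxx; rewrite lim_cst.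
Qed.

Lemma completion_mdist_positivity x y : completion_mdist x y = 0 -> x = y.
Proof.
elim/cauchy_limW: x => u; elim/cauchy_limW: y => v uv; apply/completionP.
by rewrite -[X in _ --> X]uv; exact: cvg_completion_mdist.
Qed.

Lemma completion_mdist_sym x y : completion_mdist x y = completion_mdist y x.
Proof.
by rewrite /completion_mdist; under eq_fun do rewrite metric_sym.
Qed.

Lemma completion_mdist_triangle y x z :
  completion_mdist x z <= completion_mdist x y + completion_mdist y z.
Proof.
elim/cauchy_limW: x => u; elim/cauchy_limW: y => v; elim/cauchy_limW: z => w.
have uv := cvg_completion_mdist (u := u) (v := v).
have vw := cvg_completion_mdist (u := v) (v := w).
have uw := cvg_completion_mdist (u := u) (v := w).
have uvw : mdist (u k) (v k) + mdist (v k) (w k) @[k --> \oo] -->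
    completion_mdist (cauchy_lim u) (cauchy_lim v) +
    completion_mdist (cauchy_lim v) (cauchy_lim w).
  exact: cvgD uv vw.
apply: ler_cvg_to uw uvw _.
by apply: nearW => k; exact: metric_triangle.
Qed.

HB.instance Definition _ := isMetric.Build R completion completion_mdistxx
  completion_mdist_positivity completion_mdist_sym completion_mdist_triangle.

Lemma cauchy_cst (x : T) : cauchy ((fun=> x) @ \oo : set_system T).
Proof. by apply/cauchy_seqE => e e0; exists 0%N => *; rewrite mdistxx. Qed.

Definition to_completion (x : T) : completion :=
  cauchy_lim (mk_cauchy_seq (cauchy_cst x)).

Lemma to_completion_isometry x y :
  mdist (to_completion x) (to_completion y) = mdist x y.
Proof. by rewrite [LHS]completion_mdistE /= lim_cst. Qed.

Lemma cvg_to_completion (u : cauchy_seq) :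
  to_completion (u k) @[k --> \oo] --> cauchy_lim u.
Proof.
apply/cvg_ballP => e e0; have e2 : 0 < e / 2 by rewrite divr_gt0.
have [N uN] := cauchy_seqP u e2.
exists N => // k /= Nk; rewrite ballEmdist /= metric_sym.
rewrite (@le_lt_trans _ _ (e / 2))//; last first.
  by rewrite ltr_pdivrMr// ltr_pMr// ltr1n.
have H := cvg_completion_mdist (u := mk_cauchy_seq (cauchy_cst (u k))) (v := u).
apply: (ler_cvg_to H (cvg_cst (e / 2))).
by exists N => // j /= Nj; apply/ltW/uN.
Qed.

Lemma to_completion_dense : dense (range to_completion).
Proof.
move=> O [x Ox] oO; rewrite -[x]cauchy_limK in Ox.
have [N _ uO] := cvg_to_completion (u := repr x) (open_nbhs_nbhs (conj oO Ox)).
by exists (to_completion (repr x N)); split; [exact: uO (leqnn N)|exists (repr x N)].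
Qed.

Lemma completion_complete (F : set_system completion) :
  ProperFilter F -> cauchy F -> exists x : completion, F --> x.
Proof.
move=> PF /cauchyP cF.
have yP (k : nat) : exists y, F (ball (to_completion y) (k.+1%:R^-1 : R)).
  pose e : R := k.+1%:R^-1 / 2.
  have e0 : 0 < e by rewrite divr_gt0// invr_gt0.
  have [x Fx] := cF e e0.
  have /cvg_ballP/(_ e e0)[N _ /(_ N (leqnn N)) /=] :=
    cvg_to_completion (u := repr x).
  rewrite cauchy_limK => xy; exists (repr x N); apply: filterS Fx => z xz.
  by apply: (ball_splitr xy xz).
have [y yF] := choice yP.
have cy : cauchy (y @ \oo).
  apply/cauchy_seqE => e e0; have e2 : 0 < e / 2 by rewrite divr_gt0.
  have [N _ HN] := near_infty_natSinv_lt (PosNum e2).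
  exists N => i j Ni Nj.
  have [z [yiz yjz]] := filter_ex (filterI (yF i) (yF j)).
  move: yiz yjz; rewrite !ballEmdist /= => yiz yjz.
  rewrite -to_completion_isometry (le_lt_trans (metric_triangle _ z _))//.
  rewrite (splitr e) ltrD//; first exact: lt_trans yiz (HN i Ni).
  by rewrite metric_sym; exact: lt_trans yjz (HN j Nj).
exists (cauchy_lim (mk_cauchy_seq cy)).
apply/cvg_ballP => e e0; have e2 : 0 < e / 2 by rewrite divr_gt0.
have /cvg_ballP /(_ (e / 2) e2) [N _ HN] := cvg_to_completion (u := mk_cauchy_seq cy).
have [N' _ HN'] := near_infty_natSinv_lt (PosNum e2).
pose k := maxn N N'.
have := HN k (leq_maxl _ _); have := HN' k (leq_maxr _ _) => /= kN' kN.
apply: filterS (yF k) => z yz.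
apply: (ball_split kN); exact: le_ball (ltW kN') _ yz.
Qed.

End CauchySeq.

Section CompletionMap.
Context {R : realType} (T : metricType R).

Section Map1.
Context (f : T -> T) (f_lip : forall x y, mdist (f x) (f y) <= mdist x y).

Lemma cauchy_map1 (u : cauchy_seq T) : cauchy ((f \o u) @ \oo).
Proof.
apply/cauchy_seqE => e /(cauchy_seqP u)[N uN].
by exists N => i j Ni Nj; exact: le_lt_trans (f_lip _ _) (uN i j Ni Nj).
Qed.

Definition completion_map1 (x : completion T) : completion T :=
  cauchy_lim (mk_cauchy_seq (cauchy_map1 (repr x))).

Lemma completion_map1E u : completion_map1 (cauchy_lim u) =
  cauchy_lim (mk_cauchy_seq (cauchy_map1 u)).
Proof.
apply/completionP => /=.
have h : mdist (repr (cauchy_lim u) k) (u k) @[k --> \oo] --> (0 : R).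
  by apply/completionP; rewrite cauchy_limK.
apply: squeeze_cvgr (@cvg_cst _ 0 _ _ _) h.
by apply: nearW => k; rewrite mdist_ge0 f_lip.
Qed.

End Map1.

Section Map2.
Context (f : T -> T -> T) (f_lip : forall x y x' y',
  mdist (f x y) (f x' y') <= mdist x x' + mdist y y').

Lemma cauchy_map2 (u v : cauchy_seq T) :
  cauchy ((fun k => f (u k) (v k)) @ \oo).
Proof.
apply/cauchy_seqE => e e0; have e2 : 0 < e / 2 by rewrite divr_gt0.
have [N uN] := cauchy_seqP u e2; have [N' vN] := cauchy_seqP v e2.
exists (maxn N N') => i j; rewrite !geq_max => /andP[Ni Ni'] /andP[Nj Nj'].
rewrite (le_lt_trans (f_lip _ _ _ _))// (splitr e) ltrD//.
- exact: uN.
- exact: vN.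
Qed.

Definition completion_map2 (x y : completion T) : completion T :=
  cauchy_lim (mk_cauchy_seq (cauchy_map2 (repr x) (repr y))).

Lemma completion_map2E u v :
  completion_map2 (cauchy_lim u) (cauchy_lim v) =
  cauchy_lim (mk_cauchy_seq (cauchy_map2 u v)).
Proof.
apply/completionP => /=.
have hu : mdist (repr (cauchy_lim u) k) (u k) @[k --> \oo] --> (0 : R).
  by apply/completionP; rewrite cauchy_limK.
have hv : mdist (repr (cauchy_lim v) k) (v k) @[k --> \oo] --> (0 : R).
  by apply/completionP; rewrite cauchy_limK.
have h : mdist (repr (cauchy_lim u) k) (u k) +
    mdist (repr (cauchy_lim v) k) (v k) @[k --> \oo] --> (0 : R).
  by rewrite -[X in _ --> X]addr0; exact: cvgD.
apply: squeeze_cvgr (@cvg_cst _ 0 _ _ _) h.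
by apply: nearW => k; rewrite mdist_ge0 f_lip.
Qed.

End Map2.

Lemma eq_cauchy_lim (u v : cauchy_seq T) : u =1 v ->
  cauchy_lim u = cauchy_lim v.
Proof. by move=> uv; congr (cauchy_lim _); apply/val_inj/funext. Qed.

End CompletionMap.

Opaque cauchy_lim.

(* Only nonexpansiveness of the ring operations is needed to extend them to the
   completion.  The metric topology is put on the alias [metric_space A] below,
   because the library's topological modules have numeric scalars. *)
HB.mixin Record isMetricAlgebra (F : fieldType) (R : realType) A
    of GRing.Algebra F A := {
  adist : A -> A -> R;
  adistxx : forall x, adist x x = 0;
  adist_positivity : forall x y, adist x y = 0 -> x = y;
  adist_sym : forall x y, adist x y = adist y x;
  adist_triangle : forall y x z, adist x z <= adist x y + adist y z;
  adistDr : forall z x y, adist (x + z) (y + z) = adist x y;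
  adistMl : forall z x y, adist (z * x) (z * y) <= adist x y;
  adistMr : forall z x y, adist (x * z) (y * z) <= adist x y
}.

#[short(type="metricAlgType")]
HB.structure Definition MetricAlgebra (F : fieldType) (R : realType) :=
  {A of isMetricAlgebra F R A & GRing.Algebra F A}.

Section MetricSpace.
Context {F : fieldType} {R : realType} (A : metricAlgType F R).

Definition metric_space : Type := A.

HB.instance Definition _ := Choice.on metric_space.
HB.instance Definition _ := isMetric.Build R metric_space
  (@adistxx F R A) (@adist_positivity F R A) (@adist_sym F R A)
  (@adist_triangle F R A).

End MetricSpace.

Section MetricAlgebraTheory.
Context {F : fieldType} {R : realType} (A : metricAlgType F R).

Lemma adistD_lip (x y x' y' : A) :
  adist (x + y) (x' + y') <= adist x x' + adist y y'.
Proof.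
rewrite (le_trans (adist_triangle (x' + y) _ _))// adistDr lerD2l.
by rewrite ![x' + _]addrC adistDr.
Qed.

Lemma adistN_lip (x y : A) : adist (- x) (- y) <= adist x y.
Proof.
by rewrite -(adistDr (x + y)) addKr [x + y]addrC addKr adist_sym.
Qed.

Lemma adistM_lip (x y x' y' : A) :
  adist (x * y) (x' * y') <= adist x x' + adist y y'.
Proof.
by rewrite (le_trans (adist_triangle (x' * y) _ _))// lerD ?adistMr ?adistMl.
Qed.

Lemma adistZ_lip (a : F) (x y : A) : adist (a *: x) (a *: y) <= adist x y.
Proof. by rewrite -[x]mul1r -[y]mul1r !scalerAl (le_trans (adistMl _ _ _)) ?mul1r. Qed.

End MetricAlgebraTheory.

Section CompletionAlgebra.
Context {F : fieldType} {R : realType} (A : metricAlgType F R).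

Definition alg_completion : Type := completion (metric_space A).

HB.instance Definition _ := Choice.on alg_completion.

Local Notation M := alg_completion.
Local Notation cseq := (cauchy_seq (metric_space A)).

Let limW (P : M -> Prop) :
  (forall u : cseq, P (cauchy_lim u)) -> forall x, P x.
Proof. exact: cauchy_limW. Qed.

Let zero : M := to_completion (0 : metric_space A).
Let one : M := to_completion (1 : metric_space A).
Let add : M -> M -> M := completion_map2 (T := metric_space A) (@adistD_lip F R A).
Let opp : M -> M := completion_map1 (T := metric_space A) (@adistN_lip F R A).
Let mul : M -> M -> M := completion_map2 (T := metric_space A) (@adistM_lip F R A).
Let scale (a : F) : M -> M := completion_map1 (T := metric_space A) (@adistZ_lip F R A a).

Let addA : associative add.
Proof.
elim/limW=> u; elim/limW=> v; elim/limW=> w; rewrite /add !completion_map2E.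
by apply: eq_cauchy_lim => k; exact: (@addrA A).
Qed.

Let addC : commutative add.
Proof.
elim/limW=> u; elim/limW=> v; rewrite /add !completion_map2E.
by apply: eq_cauchy_lim => k; exact: (@addrC A).
Qed.

Let add0 : left_id zero add.
Proof.
elim/limW=> u; rewrite /add !completion_map2E.
by apply: eq_cauchy_lim => k; exact: (@add0r A).
Qed.

Let addN : left_inverse zero opp add.
Proof.
elim/limW=> u; rewrite /add /opp completion_map1E completion_map2E.
by apply: eq_cauchy_lim => k; exact: (@addNr A).
Qed.

Let mulA : associative mul.
Proof.
elim/limW=> u; elim/limW=> v; elim/limW=> w; rewrite /mul !completion_map2E.
by apply: eq_cauchy_lim => k; exact: (@mulrA A).
Qed.

Let mul1 : left_id one mul.
Proof.
elim/limW=> u; rewrite /mul !completion_map2E.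
by apply: eq_cauchy_lim => k; exact: (@mul1r A).
Qed.

Let mulr1_ : right_id one mul.
Proof.
elim/limW=> u; rewrite /mul !completion_map2E.
by apply: eq_cauchy_lim => k; exact: (@mulr1 A).
Qed.

Let mulDl : left_distributive mul add.
Proof.
elim/limW=> u; elim/limW=> v; elim/limW=> w.
rewrite /mul /add !completion_map2E.
by apply: eq_cauchy_lim => k; exact: (@mulrDl A).
Qed.

Let mulDr : right_distributive mul add.
Proof.
elim/limW=> u; elim/limW=> v; elim/limW=> w.
rewrite /mul /add !completion_map2E.
by apply: eq_cauchy_lim => k; exact: (@mulrDr A).
Qed.

Let one_neq0 : one != zero.
Proof.
by rewrite -mdist_gt0 to_completion_isometry mdist_gt0 oner_neq0.
Qed.

HB.instance Definition _ :=
  GRing.isNzRing.Build M addA addC add0 addN mulA mul1 mulr1_ mulDl mulDr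
    one_neq0.

Let scaleA a b (x : M) : scale a (scale b x) = scale (a * b) x.
Proof.
elim/limW: x => u; rewrite /scale !completion_map1E.
by apply: eq_cauchy_lim => k; exact: (@scalerA F A).
Qed.

Let scale1 : left_id 1 scale.
Proof.
elim/limW => u; rewrite /scale !completion_map1E.
by apply: eq_cauchy_lim => k; exact: (@scale1r F A).
Qed.

Let scaleDr : right_distributive scale +%R.
Proof.
move=> a; elim/limW=> u; elim/limW=> v.
rewrite /GRing.add /= /scale /add !(completion_map1E, completion_map2E).
by apply: eq_cauchy_lim => k; exact: (@scalerDr F A).
Qed.

Let scaleDl (x : M) : {morph scale^~ x : a b / a + b}.
Proof.
move=> a b; elim/limW: x => u.
rewrite [in RHS]/GRing.add /= /scale /add !(completion_map1E, completion_map2E).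
by apply: eq_cauchy_lim => k; exact: (@scalerDl F A).
Qed.

HB.instance Definition _ :=
  GRing.Zmodule_isLmodule.Build F M scaleA scale1 scaleDr scaleDl.

Let scaleAl (a : F) (x y : M) : a *: (x * y) = (a *: x) * y.
Proof.
elim/limW: x => u; elim/limW: y => v.
rewrite /GRing.scale /GRing.mul /= /scale /mul !(completion_map1E, completion_map2E).
by apply: eq_cauchy_lim => k; exact: (@scalerAl F A).
Qed.

HB.instance Definition _ := GRing.Lmodule_isLalgebra.Build F M scaleAl.

Let scaleAr (a : F) (x y : M) : a *: (x * y) = x * (a *: y).
Proof.
elim/limW: x => u; elim/limW: y => v.
rewrite /GRing.scale /GRing.mul /= /scale /mul !(completion_map1E, completion_map2E).
by apply: eq_cauchy_lim => k; exact: (@scalerAr F A).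
Qed.

HB.instance Definition _ := GRing.Lalgebra_isAlgebra.Build F M scaleAr.

Lemma cauchy_limD (u v : cseq) : (cauchy_lim u : M) + cauchy_lim v =
  cauchy_lim (mk_cauchy_seq (cauchy_map2 (T := metric_space A) (@adistD_lip F R A) u v)).
Proof. exact: completion_map2E. Qed.

Lemma cauchy_limM (u v : cseq) : (cauchy_lim u : M) * cauchy_lim v =
  cauchy_lim (mk_cauchy_seq (cauchy_map2 (T := metric_space A) (@adistM_lip F R A) u v)).
Proof. exact: completion_map2E. Qed.

Lemma cauchy_limZ a (u : cseq) : a *: (cauchy_lim u : M) =
  cauchy_lim (mk_cauchy_seq (cauchy_map1 (T := metric_space A) (@adistZ_lip F R A a) u)).
Proof. exact: completion_map1E. Qed.

Let dist (x y : M) : R := mdist (x : completion (metric_space A)) y.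

Let cvg_dist (u v : cseq) :
  adist (u k : A) (v k) @[k --> \oo] --> dist (cauchy_lim u) (cauchy_lim v).
Proof. exact: (@cvg_completion_mdist R (metric_space A) u v). Qed.

Let distxx x : dist x x = 0.
Proof. exact: mdistxx. Qed.

Let dist_positivity x y : dist x y = 0 -> x = y.
Proof. exact: mdist_positivity. Qed.

Let dist_sym x y : dist x y = dist y x.
Proof. exact: metric_sym. Qed.

Let dist_triangle y x z : dist x z <= dist x y + dist y z.
Proof. exact: metric_triangle. Qed.

Let distDr (z x y : M) : dist (x + z) (y + z) = dist x y.
Proof.
elim/limW: x => u; elim/limW: y => v; elim/limW: z => w.
rewrite !cauchy_limD.
have := @cvg_dist (mk_cauchy_seq (cauchy_map2 (T := metric_space A) (@adistD_lip F R A) u w))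
  (mk_cauchy_seq (cauchy_map2 (T := metric_space A) (@adistD_lip F R A) v w)).
under eq_fun do rewrite /= adistDr.
by move=> h; exact: (cvg_unique _ h (@cvg_dist u v)).
Qed.

Let distMl (z x y : M) : dist (z * x) (z * y) <= dist x y.
Proof.
elim/limW: x => u; elim/limW: y => v; elim/limW: z => w.
rewrite !cauchy_limM.
apply: ler_cvg_to (@cvg_dist _ _) (@cvg_dist _ _) _.
by apply: nearW => k; exact: adistMl.
Qed.

Let distMr (z x y : M) : dist (x * z) (y * z) <= dist x y.
Proof.
elim/limW: x => u; elim/limW: y => v; elim/limW: z => w.
rewrite !cauchy_limM.
apply: ler_cvg_to (@cvg_dist _ _) (@cvg_dist _ _) _.
by apply: nearW => k; exact: adistMr.
Qed.

HB.instance Definition _ := isMetricAlgebra.Build F R M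
  distxx dist_positivity dist_sym dist_triangle distDr distMl distMr.

Definition to_alg_completion (x : A) : M := to_completion (x : metric_space A).

Lemma to_alg_completion_isometry x y :
  adist (to_alg_completion x) (to_alg_completion y) = adist x y.
Proof. exact: to_completion_isometry. Qed.

Lemma to_alg_completion_is_linear : linear to_alg_completion.
Proof.
move=> a x y; rewrite /to_alg_completion cauchy_limZ cauchy_limD.
exact: eq_cauchy_lim.
Qed.

Lemma to_alg_completion_is_monoid_morphism : monoid_morphism to_alg_completion.
Proof.
by split=> // x y; rewrite [RHS]cauchy_limM; exact: eq_cauchy_lim.
Qed.

Lemma to_alg_completion_dense (x : M) (e : R) : 0 < e ->
  exists y, adist x (to_alg_completion y) < e.
Proof.
move=> e0; rewrite -[x]cauchy_limK.
have /cvg_ballP/(_ e e0)[N _ /(_ N (leqnn N)) /=] :=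
  cvg_to_completion (u := repr (x : completion (metric_space A))).
by move=> h; exists (repr (x : completion (metric_space A)) N).
Qed.

Lemma alg_completion_complete (u : nat -> M) :
  (forall e : R, 0 < e -> exists N, forall i j, (N <= i)%N -> (N <= j)%N ->
    adist (u i) (u j) < e) ->
  exists x : M, forall e : R, 0 < e -> exists N, forall i, (N <= i)%N ->
    adist x (u i) < e.
Proof.
move=> /(@cauchy_seqE R (completion (metric_space A))) /completion_complete[x ux].
exists x => e e0; move/cvg_ballP : ux => /(_ e e0)[N _ uN].
by exists N => i Ni; have := uN i Ni; rewrite ballEmdist.
Qed.

End CompletionAlgebra.

Transparent cauchy_lim.

Section Iota.
Context {F : fieldType}.

(* The map x |-> x (x) 1_(n/m).  When m %| n, [conform_mx] only casts along
   m * (n %/ m) = n; otherwise the value is the junk 0. *)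
Definition iota_mx (m n : nat) (x : 'M[F]_m) : 'M[F]_n :=
  conform_mx 0 (x *t (1%:M : 'M_(n %/ m))).
Arguments iota_mx : clear implicits.

Lemma iota_mxE m n (x : 'M[F]_m) (i j : 'I_n) (i' j' : 'I_m) :
  (m %| n)%N -> i' = (i %/ (n %/ m))%N :> nat -> j' = (j %/ (n %/ m))%N :> nat ->
  iota_mx m n x i j = x i' j' *+ (i %% (n %/ m) == j %% (n %/ m))%N.
Proof.
move=> mn; rewrite /iota_mx; move: (n %/ m)%N (divnK mn) => r rE.
move: rE i j; rewrite mulnC => <- i j; rewrite conform_mx_id.
case: (mxtens_indexP i) => i0 i1; case: (mxtens_indexP j) => j0 j1.
rewrite tensmxE mxE /=.
have r0 : (0 < r)%N by rewrite (leq_ltn_trans _ (ltn_ord i1)).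
rewrite !divnMDl// !divn_small// !addn0 !modnMDl !modn_small//.
by move=> /val_inj -> /val_inj ->; rewrite mulr_natr.
Qed.

Lemma iota_mx_ord m n (i : 'I_n) : (m %| n)%N ->
  exists i' : 'I_m, i' = (i %/ (n %/ m))%N :> nat.
Proof.
move=> mn; have n0 : (0 < n)%N by rewrite (leq_ltn_trans _ (ltn_ord i)).
have r0 : (0 < n %/ m)%N by rewrite divn_gt0 ?(dvdn_leq n0 mn) ?(dvdn_gt0 n0 mn).
have h : (i %/ (n %/ m) < m)%N by rewrite ltn_divLR// mulnC divnK.
by exists (Ordinal h).
Qed.

Lemma iota_mx_id m (x : 'M[F]_m) : iota_mx m m x = x.
Proof.
apply/matrixP => i j; have m0 : (0 < m)%N by rewrite (leq_ltn_trans _ (ltn_ord i)).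
rewrite (@iota_mxE _ _ _ _ _ i j) ?dvdnn ?divnn ?m0 ?divn1//.
by rewrite !modn1 eqxx.
Qed.

Lemma iota_mx_comp m n l (x : 'M[F]_m) : (m %| n)%N -> (n %| l)%N ->
  iota_mx n l (iota_mx m n x) = iota_mx m l x.
Proof.
move=> mn nl; apply/matrixP => i j; have ml := dvdn_trans mn nl.
have [i' i'E] := iota_mx_ord i nl; have [j' j'E] := iota_mx_ord j nl.
have [i2 i2E] := iota_mx_ord i' mn; have [j2 j2E] := iota_mx_ord j' mn.
have l0 : (0 < l)%N by rewrite (leq_ltn_trans _ (ltn_ord i)).
have n0 := dvdn_gt0 l0 nl; have m0 := dvdn_gt0 n0 mn.
rewrite (iota_mxE _ nl i'E j'E) (iota_mxE _ mn i2E j2E).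
have rE : (l %/ m = (n %/ m) * (l %/ n))%N.
  by rewrite divn_mulAC// [in RHS]mulnC divnK.
rewrite (@iota_mxE _ _ _ _ _ i2 j2 ml); last 2 first.
- by rewrite i2E i'E rE mulnC divnMA.
- by rewrite j2E j'E rE mulnC divnMA.
rewrite -mulrnA mulnb; congr (_ *+ nat_of_bool _).
rewrite i'E j'E rE !modn_divl; set s := (n %/ m * (l %/ n))%N; set r := (l %/ n)%N.
have r0 : (0 < r)%N by rewrite divn_gt0 ?(dvdn_leq l0 nl).
apply/andP/eqP => [[/eqP h1 /eqP h2]|h].
- rewrite (divn_eq (i %% s) r) (divn_eq (j %% s) r) h1; congr (_ + _)%N.
  by rewrite !modn_dvdm// dvdn_mull.
- rewrite h eqxx; split=> //; apply/eqP.
  by rewrite -(@modn_dvdm s i r) ?h ?modn_dvdm ?dvdn_mull.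
Qed.

Lemma iota_mxD m n (x y : 'M[F]_m) : (m %| n)%N ->
  iota_mx m n (x + y) = iota_mx m n x + iota_mx m n y.
Proof.
move=> mn; apply/matrixP => i j.
have [i' i'E] := iota_mx_ord i mn; have [j' j'E] := iota_mx_ord j mn.
by rewrite mxE !(iota_mxE _ mn i'E j'E) mxE mulrnDl.
Qed.

Lemma iota_mxZ m n a (x : 'M[F]_m) : (m %| n)%N ->
  iota_mx m n (a *: x) = a *: iota_mx m n x.
Proof.
move=> mn; apply/matrixP => i j.
have [i' i'E] := iota_mx_ord i mn; have [j' j'E] := iota_mx_ord j mn.
by rewrite mxE !(iota_mxE _ mn i'E j'E) mxE mulrnAr.
Qed.

Lemma iota_mxN m n (x : 'M[F]_m) : (m %| n)%N -> iota_mx m n (- x) = - iota_mx m n x.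
Proof. by move=> mn; rewrite -!scaleN1r iota_mxZ. Qed.

Lemma iota_mxB m n (x y : 'M[F]_m) : (m %| n)%N ->
  iota_mx m n (x - y) = iota_mx m n x - iota_mx m n y.
Proof. by move=> mn; rewrite iota_mxD// iota_mxN. Qed.

Lemma iota_mxM m n (x y : 'M[F]_m) : (m %| n)%N ->
  iota_mx m n (x *m y) = iota_mx m n x *m iota_mx m n y.
Proof.
move=> mn; rewrite /iota_mx; move: (n %/ m)%N (divnK mn) => r; rewrite mulnC => <-.
by rewrite !conform_mx_id tensmx_mul mulmx1.
Qed.

Lemma iota_mx_pid m n k : (m %| n)%N -> (k <= m)%N ->
  iota_mx m n (pid_mx k) = pid_mx (k * (n %/ m)).
Proof.
move=> mn km; apply/matrixP => i j.
have [i' i'E] := iota_mx_ord i mn; have [j' j'E] := iota_mx_ord j mn.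
rewrite (iota_mxE _ mn i'E j'E) !mxE -mulrnA mulnb; congr (nat_of_bool _)%:R.
have n0 : (0 < n)%N by rewrite (leq_ltn_trans _ (ltn_ord i)).
have m0 := dvdn_gt0 n0 mn.
have r0 : (0 < n %/ m)%N by rewrite divn_gt0 ?(dvdn_leq n0 mn).
rewrite i'E j'E ltn_divLR// andbAC; congr (_ && _).
apply/andP/eqP => [[/eqP h1 /eqP h2]|->//].
by rewrite (divn_eq i (n %/ m)) (divn_eq j (n %/ m)) h1 h2.
Qed.

Lemma iota_mx1 m n : (m %| n)%N -> iota_mx m n 1%:M = 1%:M.
Proof.
by move=> mn; rewrite -(pid_mx_1 F m) iota_mx_pid// mulnC divnK// pid_mx_1.
Qed.

Lemma iota_mx_unit m n (x : 'M[F]_m) : (m %| n)%N -> x \in unitmx ->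
  iota_mx m n x \in unitmx.
Proof.
move=> mn xu; apply: (@mulmx1_unit _ _ _ (iota_mx m n (invmx x)) _).1.
by rewrite -iota_mxM// mulmxV// iota_mx1.
Qed.

Lemma rank_iota_mx m n (x : 'M[F]_m) : (m %| n)%N ->
  \rank (iota_mx m n x) = (\rank x * (n %/ m))%N.
Proof.
move=> mn; rewrite -[in LHS](mulmx_ebase x) !iota_mxM//.
rewrite mxrankMfree ?row_free_unit ?iota_mx_unit ?row_ebase_unit//.
rewrite -mxrank_tr trmx_mul mxrankMfree ?mxrank_tr; last first.
  by rewrite row_free_unit unitmx_tr iota_mx_unit ?col_ebase_unit.
rewrite iota_mx_pid ?rank_leq_row// rank_pid_mx//.
- by rewrite -[leqRHS](divnK mn) mulnC leq_mul ?rank_leq_row.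
- by rewrite -[leqRHS](divnK mn) mulnC leq_mul ?rank_leq_row.
Qed.

End Iota.
Arguments iota_mx {F} m n x.

Record factor_sequence := FactorSequence {
  fs_val :> nat -> nat;
  fs_gt0 : forall k, (0 < fs_val k)%N;
  fs_dvdS : forall k, (fs_val k %| fs_val k.+1)%N;
  fs_cvg : fs_val k @[k --> \oo] --> \oo
}.

Lemma fs_dvd (n : factor_sequence) k l : (k <= l)%N -> (n k %| n l)%N.
Proof.
move=> /subnK <-; elim: (l - k)%N => // d IHd.
exact: dvdn_trans IHd (fs_dvdS n _).
Qed.

Section DirectLimit.
Context {F : fieldType} (n : factor_sequence).

Definition predirlim := {k : nat & 'M[F]_(n k)}.

(* By [iota_mx_comp], the composite connecting map from level k to level l is
   [iota_mx (n k) (n l)]. *)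
Definition dirlim_equiv (x y : predirlim) :=
  let N := n (maxn (tag x) (tag y)) in
  iota_mx _ N (tagged x) == iota_mx _ N (tagged y).

Let dvdL k l : (n k %| n (maxn k l))%N. Proof. exact/fs_dvd/leq_maxl. Qed.
Let dvdR k l : (n l %| n (maxn k l))%N. Proof. exact/fs_dvd/leq_maxr. Qed.

Lemma iota_mx_inj k l (x y : 'M[F]_(n k)) : (k <= l)%N ->
  iota_mx _ (n l) x = iota_mx _ (n l) y -> x = y.
Proof.
move=> kl /eqP; rewrite -subr_eq0 -iota_mxB ?fs_dvd// -mxrank_eq0.
rewrite rank_iota_mx ?fs_dvd// muln_eq0 mxrank_eq0 subr_eq0 => /orP[/eqP//|].
by rewrite -leqn0 leqNgt divn_gt0 ?fs_gt0// dvdn_leq ?fs_gt0// fs_dvd.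
Qed.

Lemma dirlim_equivP (x y : predirlim) N :
  (tag x <= N)%N -> (tag y <= N)%N ->
  reflect (iota_mx _ (n N) (tagged x) = iota_mx _ (n N) (tagged y))
    (dirlim_equiv x y).
Proof.
move=> xN yN; have maxN : (maxn (tag x) (tag y) <= N)%N by rewrite geq_max xN.
apply: (iffP eqP) => [|xy].
- by move=> /(congr1 (iota_mx _ (n N))); rewrite !iota_mx_comp ?fs_dvd ?leq_maxl ?leq_maxr.
- by apply: (iota_mx_inj maxN); rewrite !iota_mx_comp ?fs_dvd ?leq_maxl ?leq_maxr.
Qed.

Lemma dirlim_equiv_refl : reflexive dirlim_equiv.
Proof. by move=> x; apply/eqP. Qed.

Lemma dirlim_equiv_sym : symmetric dirlim_equiv.
Proof. by move=> x y; rewrite /dirlim_equiv maxnC eq_sym. Qed.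

Lemma dirlim_equiv_trans : transitive dirlim_equiv.
Proof.
move=> y x z; pose N := maxn (tag x) (maxn (tag y) (tag z)).
have xN : (tag x <= N)%N by rewrite leq_max leqnn.
have yN : (tag y <= N)%N by rewrite !leq_max leqnn orbT.
have zN : (tag z <= N)%N by rewrite !leq_max leqnn !orbT.
move=> /(dirlim_equivP xN yN) xy /(dirlim_equivP yN zN) yz.
by apply/(dirlim_equivP xN zN); rewrite xy.
Qed.

Canonical dirlim_equiv_rel :=
  EquivRel dirlim_equiv dirlim_equiv_refl dirlim_equiv_sym dirlim_equiv_trans.

Definition dirlim := {eq_quot dirlim_equiv}.

HB.instance Definition _ := Choice.on dirlim.
HB.instance Definition _ := EqQuotient.on dirlim.

Definition to_dirlim k (x : 'M[F]_(n k)) : dirlim :=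
  \pi_dirlim (Tagged (fun k => 'M[F]_(n k)) x).

Lemma to_dirlim_eq k l (x : 'M[F]_(n k)) (y : 'M[F]_(n l)) N :
  (k <= N)%N -> (l <= N)%N ->
  to_dirlim x = to_dirlim y <-> iota_mx _ (n N) x = iota_mx _ (n N) y.
Proof.
move=> kN lN; split.
- by move=> /eqmodP /(dirlim_equivP (x := Tagged _ x) (y := Tagged _ y) kN lN).
- move=> xy; apply/eqmodP.
  by apply/(dirlim_equivP (x := Tagged _ x) (y := Tagged _ y) kN lN).
Qed.

Lemma to_dirlim_iota k l (x : 'M[F]_(n k)) : (k <= l)%N ->
  to_dirlim (iota_mx _ (n l) x) = to_dirlim x.
Proof.
by move=> kl; apply/(to_dirlim_eq _ _ (leqnn l) kl); rewrite iota_mx_id.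
Qed.

Lemma to_dirlim_inj k : injective (@to_dirlim k).
Proof.
by move=> x y /(to_dirlim_eq _ _ (leqnn k) (leqnn k)); rewrite !iota_mx_id.
Qed.

Lemma to_dirlim_repr (x : dirlim) : to_dirlim (tagged (repr x)) = x.
Proof. by rewrite -[RHS]reprK /to_dirlim; congr (\pi _); case: (repr x). Qed.

Lemma dirlimW (x : dirlim) : exists k (u : 'M[F]_(n k)), x = to_dirlim u.
Proof. by exists (tag (repr x)), (tagged (repr x)); rewrite to_dirlim_repr. Qed.

Lemma dirlimW2 (x y : dirlim) : exists k (u v : 'M[F]_(n k)),
  x = to_dirlim u /\ y = to_dirlim v.
Proof.
have [k [u ->]] := dirlimW x; have [l [v ->]] := dirlimW y.
exists (maxn k l), (iota_mx _ _ u), (iota_mx _ _ v).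
by rewrite !to_dirlim_iota ?leq_maxl ?leq_maxr.
Qed.

Lemma dirlimW3 (x y z : dirlim) : exists k (u v w : 'M[F]_(n k)),
  [/\ x = to_dirlim u, y = to_dirlim v & z = to_dirlim w].
Proof.
have [k [u [v [-> ->]]]] := dirlimW2 x y; have [l [w ->]] := dirlimW z.
exists (maxn k l), (iota_mx _ _ u), (iota_mx _ _ v), (iota_mx _ _ w).
by rewrite !to_dirlim_iota ?leq_maxl ?leq_maxr.
Qed.

(* Operations are computed on representatives moved to a common level. *)
Definition dirlim_map2 T (f : forall k, 'M[F]_(n k) -> 'M[F]_(n k) -> T)
    (x y : dirlim) : T :=
  let N := maxn (tag (repr x)) (tag (repr y)) in
  f N (iota_mx _ _ (tagged (repr x))) (iota_mx _ _ (tagged (repr y))).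

Lemma dirlim_map2E T (f : forall k, 'M[F]_(n k) -> 'M[F]_(n k) -> T) k
    (x y : 'M[F]_(n k)) :
  (forall k l (u v : 'M[F]_(n k)), (k <= l)%N ->
    f l (iota_mx _ _ u) (iota_mx _ _ v) = f k u v) ->
  dirlim_map2 f (to_dirlim x) (to_dirlim y) = f k x y.
Proof.
move=> f_iota; rewrite /dirlim_map2.
move: (to_dirlim_repr (to_dirlim x)) (to_dirlim_repr (to_dirlim y)).
case: (repr _) => i u /=; case: (repr _) => j v /= ux vy.
set N := maxn i j; pose N' := maxn N k.
have NN : (N <= N')%N := leq_maxl _ _; have kN : (k <= N')%N := leq_maxr _ _.
have iN : (i <= N')%N := leq_trans (leq_maxl _ _) NN.
have jN : (j <= N')%N := leq_trans (leq_maxr _ _) NN.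
rewrite -(f_iota _ _ _ _ NN) !iota_mx_comp ?fs_dvd ?leq_maxl ?leq_maxr//.
move: ux vy => /(to_dirlim_eq _ _ iN kN) -> /(to_dirlim_eq _ _ jN kN) ->.
exact: f_iota.
Qed.

Let zero : dirlim := to_dirlim (0 : 'M_(n 0%N)).
Let one : dirlim := to_dirlim (1%:M : 'M_(n 0%N)).
Let add : dirlim -> dirlim -> dirlim :=
  dirlim_map2 (fun k x y => to_dirlim (x + y)).
Let mul : dirlim -> dirlim -> dirlim :=
  dirlim_map2 (fun k x y => to_dirlim (x *m y)).
Let opp (x : dirlim) : dirlim := to_dirlim (- tagged (repr x)).
Let scale (a : F) (x : dirlim) : dirlim := to_dirlim (a *: tagged (repr x)).

Let addE k (x y : 'M_(n k)) : add (to_dirlim x) (to_dirlim y) = to_dirlim (x + y).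
Proof.
by apply: dirlim_map2E => i j u v ij; rewrite -iota_mxD ?fs_dvd// to_dirlim_iota.
Qed.

Let mulE k (x y : 'M_(n k)) : mul (to_dirlim x) (to_dirlim y) = to_dirlim (x *m y).
Proof.
by apply: dirlim_map2E => i j u v ij; rewrite -iota_mxM ?fs_dvd// to_dirlim_iota.
Qed.

Let scaleE a k (x : 'M_(n k)) : scale a (to_dirlim x) = to_dirlim (a *: x).
Proof.
rewrite /scale; move: (to_dirlim_repr (to_dirlim x)).
case: (repr _) => i u /= /(to_dirlim_eq _ _ (leq_maxl i k) (leq_maxr i k)) ux.
apply/(to_dirlim_eq _ _ (leq_maxl i k) (leq_maxr i k)).
by rewrite !iota_mxZ// ux.
Qed.

Let oppE k (x : 'M_(n k)) : opp (to_dirlim x) = to_dirlim (- x).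
Proof.
rewrite /opp; move: (to_dirlim_repr (to_dirlim x)).
case: (repr _) => i u /= /(to_dirlim_eq _ _ (leq_maxl i k) (leq_maxr i k)) ux.
apply/(to_dirlim_eq _ _ (leq_maxl i k) (leq_maxr i k)).
by rewrite !iota_mxN// ux.
Qed.

Let zeroE k : zero = to_dirlim (0 : 'M_(n k)).
Proof.
rewrite /zero -(to_dirlim_iota _ (leq0n k)); congr to_dirlim.
by rewrite -(scale0r 0) iota_mxZ ?fs_dvd// scale0r.
Qed.

Let oneE k : one = to_dirlim (1%:M : 'M_(n k)).
Proof. by rewrite /one -(to_dirlim_iota _ (leq0n k)) iota_mx1 ?fs_dvd. Qed.

Let addA : associative add.
Proof.
by move=> x y z; have [k [u [v [w [-> -> ->]]]]] := dirlimW3 x y z;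
  rewrite !addE addrA.
Qed.

Let addC : commutative add.
Proof.
by move=> x y; have [k [u [v [-> ->]]]] := dirlimW2 x y; rewrite !addE addrC.
Qed.

Let add0 : left_id zero add.
Proof. by move=> x; have [k [u ->]] := dirlimW x; rewrite (zeroE k) addE add0r. Qed.

Let addN : left_inverse zero opp add.
Proof.
by move=> x; have [k [u ->]] := dirlimW x; rewrite oppE addE addNr -zeroE.
Qed.

Let mulA : associative mul.
Proof.
by move=> x y z; have [k [u [v [w [-> -> ->]]]]] := dirlimW3 x y z;
  rewrite !mulE mulmxA.
Qed.

Let mul1 : left_id one mul.
Proof. by move=> x; have [k [u ->]] := dirlimW x; rewrite (oneE k) mulE mul1mx. Qed.

Let mul1_ : right_id one mul.
Proof. by move=> x; have [k [u ->]] := dirlimW x; rewrite (oneE k) mulE mulmx1. Qed.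

Let mulDl : left_distributive mul add.
Proof.
by move=> x y z; have [k [u [v [w [-> -> ->]]]]] := dirlimW3 x y z;
  rewrite !(addE, mulE) mulmxDl.
Qed.

Let mulDr : right_distributive mul add.
Proof.
by move=> x y z; have [k [u [v [w [-> -> ->]]]]] := dirlimW3 x y z;
  rewrite !(addE, mulE) mulmxDr.
Qed.

Let one_neq0 : one != zero.
Proof.
apply/eqP => /to_dirlim_inj/(congr1 mxrank)/eqP.
by rewrite mxrank1 mxrank0 eqn0Ngt fs_gt0.
Qed.

HB.instance Definition _ :=
  GRing.isNzRing.Build dirlim addA addC add0 addN mulA mul1 mul1_ mulDl mulDr
    one_neq0.

Lemma to_dirlimD k (x y : 'M[F]_(n k)) :
  to_dirlim (x + y) = to_dirlim x + to_dirlim y.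
Proof. by rewrite [RHS]addE. Qed.

Lemma to_dirlimM k (x y : 'M[F]_(n k)) :
  to_dirlim (x *m y) = to_dirlim x * to_dirlim y.
Proof. by rewrite [RHS]mulE. Qed.

Lemma to_dirlimN k (x : 'M[F]_(n k)) : to_dirlim (- x) = - to_dirlim x.
Proof. by rewrite [RHS]oppE. Qed.

Lemma to_dirlim1 k : to_dirlim (1%:M : 'M[F]_(n k)) = 1.
Proof. by rewrite [RHS](oneE k). Qed.

Let scaleA a b (x : dirlim) : scale a (scale b x) = scale (a * b) x.
Proof. by have [k [u ->]] := dirlimW x; rewrite !scaleE scalerA. Qed.

Let scale1 : left_id 1 scale.
Proof. by move=> x; have [k [u ->]] := dirlimW x; rewrite !scaleE scale1r. Qed.

Let scaleDr : right_distributive scale +%R.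
Proof.
move=> a x y; have [k [u [v [-> ->]]]] := dirlimW2 x y.
by rewrite -to_dirlimD !scaleE -to_dirlimD scalerDr.
Qed.

Let scaleDl (x : dirlim) : {morph scale^~ x : a b / a + b}.
Proof.
move=> a b; have [k [u ->]] := dirlimW x.
by rewrite !scaleE -to_dirlimD scalerDl.
Qed.

HB.instance Definition _ :=
  GRing.Zmodule_isLmodule.Build F dirlim scaleA scale1 scaleDr scaleDl.

Lemma to_dirlimZ k a (x : 'M[F]_(n k)) : to_dirlim (a *: x) = a *: to_dirlim x.
Proof. by rewrite [RHS]scaleE. Qed.

Let scaleAl (a : F) (x y : dirlim) : a *: (x * y) = (a *: x) * y.
Proof.
have [k [u [v [-> ->]]]] := dirlimW2 x y.
by rewrite -to_dirlimM -!to_dirlimZ -to_dirlimM scalemxAl.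
Qed.

HB.instance Definition _ := GRing.Lmodule_isLalgebra.Build F dirlim scaleAl.

Let scaleAr (a : F) (x y : dirlim) : a *: (x * y) = x * (a *: y).
Proof.
have [k [u [v [-> ->]]]] := dirlimW2 x y.
by rewrite -to_dirlimM -!to_dirlimZ -to_dirlimM scalemxAr.
Qed.

HB.instance Definition _ := GRing.Lalgebra_isAlgebra.Build F dirlim scaleAr.

End DirectLimit.
Arguments dirlim : clear implicits.

Section DirectLimitMetric.
Context {F : fieldType} (R : realType) (n : factor_sequence).

Definition rank_dist m (x y : 'M[F]_m) : R := (\rank (x - y))%:R / m%:R.

Lemma rank_dist_iota m l (x y : 'M[F]_m) : (0 < l)%N -> (m %| l)%N ->
  rank_dist (iota_mx m l x) (iota_mx m l y) = rank_dist x y.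
Proof.
move=> l0 ml; have m0 := dvdn_gt0 l0 ml; rewrite /rank_dist -iota_mxB//.
rewrite rank_iota_mx// natrM -mulrA; congr (_ * _).
have r0 : (0 < l %/ m)%N by rewrite divn_gt0 ?(dvdn_leq l0 ml).
rewrite -[in X in _ / X](divnK ml) natrM invfM mulrA divff ?mul1r//.
by rewrite pnatr_eq0 -lt0n.
Qed.

Lemma rank_dist_xx m (x : 'M[F]_m) : rank_dist x x = 0.
Proof. by rewrite /rank_dist subrr mxrank0 mul0r. Qed.

Lemma rank_dist_eq0 m (x y : 'M[F]_m) : (0 < m)%N -> rank_dist x y = 0 -> x = y.
Proof.
move=> m0 /eqP; rewrite mulf_eq0 invr_eq0 !pnatr_eq0 (gtn_eqF m0) orbF.
by rewrite mxrank_eq0 subr_eq0 => /eqP.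
Qed.

Lemma rank_dist_sym m (x y : 'M[F]_m) : rank_dist x y = rank_dist y x.
Proof. by rewrite /rank_dist -opprB mxrank_opp. Qed.

Lemma rank_dist_triangle m (y x z : 'M[F]_m) :
  rank_dist x z <= rank_dist x y + rank_dist y z.
Proof.
rewrite /rank_dist -mulrDl ler_wpM2r ?invr_ge0// -natrD ler_nat.
by rewrite -[x - z](subrKA y) mxrank_add.
Qed.

Lemma rank_distDr m (z x y : 'M[F]_m) :
  rank_dist (x + z) (y + z) = rank_dist x y.
Proof. by rewrite /rank_dist opprD addrACA subrr addr0. Qed.

Lemma rank_distMl m (z x y : 'M[F]_m) :
  rank_dist (z *m x) (z *m y) <= rank_dist x y.
Proof.
by rewrite /rank_dist ler_wpM2r ?invr_ge0// ler_nat -mulmxBr mxrankM_maxr.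
Qed.

Lemma rank_distMr m (z x y : 'M[F]_m) :
  rank_dist (x *m z) (y *m z) <= rank_dist x y.
Proof.
by rewrite /rank_dist ler_wpM2r ?invr_ge0// ler_nat -mulmxBl mxrankM_maxl.
Qed.

Local Notation D := (dirlim F n).

Let dist : D -> D -> R := dirlim_map2 (fun k x y => rank_dist x y).

Let distE k (x y : 'M_(n k)) : dist (to_dirlim x) (to_dirlim y) = rank_dist x y.
Proof.
by apply: dirlim_map2E => i j u v ij; rewrite rank_dist_iota ?fs_gt0 ?fs_dvd.
Qed.

Let distxx x : dist x x = 0.
Proof. by have [k [u ->]] := dirlimW x; rewrite distE rank_dist_xx. Qed.

Let dist_positivity x y : dist x y = 0 -> x = y.
Proof.
have [k [u [v [-> ->]]]] := dirlimW2 x y.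
by rewrite distE => /rank_dist_eq0 ->//; exact: fs_gt0.
Qed.

Let dist_sym x y : dist x y = dist y x.
Proof.
by have [k [u [v [-> ->]]]] := dirlimW2 x y; rewrite !distE rank_dist_sym.
Qed.

Let dist_triangle y x z : dist x z <= dist x y + dist y z.
Proof.
have [k [u [v [w [-> -> ->]]]]] := dirlimW3 x y z.
by rewrite !distE rank_dist_triangle.
Qed.

Let distDr (z x y : D) : dist (x + z) (y + z) = dist x y.
Proof.
have [k [u [v [w [-> -> ->]]]]] := dirlimW3 x y z.
by rewrite -!to_dirlimD !distE rank_distDr.
Qed.

Let distMl (z x y : D) : dist (z * x) (z * y) <= dist x y.
Proof.
have [k [u [v [w [-> -> ->]]]]] := dirlimW3 x y z.
by rewrite -!to_dirlimM !distE rank_distMl.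
Qed.

Let distMr (z x y : D) : dist (x * z) (y * z) <= dist x y.
Proof.
have [k [u [v [w [-> -> ->]]]]] := dirlimW3 x y z.
by rewrite -!to_dirlimM !distE rank_distMr.
Qed.

HB.instance Definition _ := isMetricAlgebra.Build F R D
  distxx dist_positivity dist_sym dist_triangle distDr distMl distMr.

Lemma to_dirlim_isometry k (x y : 'M[F]_(n k)) :
  adist (to_dirlim x : D) (to_dirlim y) = rank_dist x y.
Proof. exact: distE. Qed.

End DirectLimitMetric.

HB.mixin Record isTopologicalGroup G of Group G & Topological G := {
  mulg_continuous : continuous (fun p : G * G => (p.1 * p.2)%g);
  invg_continuous : continuous (fun x : G => (x^-1)%g)
}.

#[short(type="topGroupType")]
HB.structure Definition TopologicalGroup :=
  {G of isTopologicalGroup G & Group G & Topological G}.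

Definition continuous_action (G : topGroupType) (X : topologicalType)
    (act : G -> X -> X) : Prop :=
  [/\ forall x, act 1%g x = x,
      forall g h x, act (g * h)%g x = act g (act h x) &
      continuous (fun p : G * X => act p.1 p.2)].

Definition extremely_amenable (G : topGroupType) : Prop :=
  forall (X : topologicalType) (act : G -> X -> X),
    compact [set: X] -> hausdorff_space X -> [set: X] !=set0 ->
    continuous_action act -> exists x, forall g, act g x = x.

Section AutomorphismGroup.
Context {F : fieldType} {R : realType} (M : metricAlgType F R).

Definition is_metric_aut (f : M -> M) : Prop :=
  [/\ bijective f, linear f, monoid_morphism f &
      forall x y, adist (f x) (f y) = adist x y].

Record metric_aut := MetricAut {
  metric_aut_val :> M -> M;
  _ : `[< is_metric_aut metric_aut_val >]
}.
HB.instance Definition _ := [isSub for metric_aut_val].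
HB.instance Definition _ := gen_eqMixin metric_aut.
HB.instance Definition _ := gen_choiceMixin metric_aut.

Lemma metric_autP (f : metric_aut) : is_metric_aut f.
Proof. by case: f => f /= /asboolP. Qed.

Lemma metric_aut_eq (f g : metric_aut) : f =1 g -> f = g.
Proof. by move=> fg; apply/val_inj/funext. Qed.

Definition mk_metric_aut (f : M -> M) (hf : is_metric_aut f) : metric_aut :=
  MetricAut (asboolT hf).

Lemma is_metric_aut_id : is_metric_aut id.
Proof. by split=> //; exists id. Qed.

Lemma is_metric_aut_comp (f g : M -> M) :
  is_metric_aut f -> is_metric_aut g -> is_metric_aut (f \o g).
Proof.
move=> [fb fl [f1 fm] fd] [gb gl [g1 gm] gd]; split.
- exact: bij_comp.
- by move=> a x y; rewrite /= gl fl.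
- by split; rewrite /= ?g1 ?f1// => x y; rewrite /= gm fm.
- by move=> x y; rewrite /= fd gd.
Qed.

Lemma is_metric_aut_inv (f g : M -> M) :
  cancel f g -> cancel g f -> is_metric_aut f -> is_metric_aut g.
Proof.
move=> fK gK [fb fl [f1 fm] fd]; split.
- by exists f.
- by move=> a x y; apply: (can_inj fK); rewrite fl !gK.
- split; first by apply: (can_inj fK); rewrite gK f1.
  by move=> x y; apply: (can_inj fK); rewrite fm !gK.
- by move=> x y; rewrite -fd !gK.
Qed.

Lemma metric_aut_inv_ex (f : metric_aut) :
  exists g : metric_aut, cancel f g /\ cancel g f.
Proof.
have [[g fK gK] _ _ _] := metric_autP f.
by exists (mk_metric_aut (is_metric_aut_inv fK gK (metric_autP f))).
Qed.

Let aut_mul (f g : metric_aut) : metric_aut :=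
  mk_metric_aut (is_metric_aut_comp (metric_autP f) (metric_autP g)).
Let aut_one : metric_aut := mk_metric_aut is_metric_aut_id.
Let aut_inv (f : metric_aut) : metric_aut := sval (cid (metric_aut_inv_ex f)).

Let aut_mulA : associative aut_mul.
Proof. by move=> f g h; exact: metric_aut_eq. Qed.
Let aut_mul1 : left_id aut_one aut_mul.
Proof. by move=> f; exact: metric_aut_eq. Qed.
Let aut_mulr1 : right_id aut_one aut_mul.
Proof. by move=> f; exact: metric_aut_eq. Qed.
Let aut_mulV : left_inverse aut_one aut_inv aut_mul.
Proof.
move=> f; apply: metric_aut_eq => x /=.
by rewrite /aut_inv; case: cid => g [/= fK _]; exact: fK.
Qed.
Let aut_mulrV : right_inverse aut_one aut_inv aut_mul.
Proof.
move=> f; apply: metric_aut_eq => x /=.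
by rewrite /aut_inv; case: cid => g [/= _ gK]; exact: gK.
Qed.

HB.instance Definition _ := isGroup.Build metric_aut
  aut_mulA aut_mul1 aut_mulr1 aut_mulV aut_mulrV.

Lemma metric_autM (f g : metric_aut) x : (f * g)%g x = f (g x).
Proof. by []. Qed.

Lemma metric_autK (f : metric_aut) : cancel f (f^-1)%g.
Proof. by move=> x; rewrite -metric_autM mulVg. Qed.

Lemma metric_autVK (f : metric_aut) : cancel (f^-1)%g f.
Proof. by move=> x; rewrite -metric_autM mulgV. Qed.

(* Basic neighborhoods of phi for the topology of pointwise convergence. *)
Definition metric_aut_nbhd (phi : metric_aut) (X : seq M) (e : R) :
    set metric_aut :=
  [set f | forall x, x \in X -> adist (f x) (phi x) < e].

Definition metric_aut_nbhs (phi : metric_aut) : set_system metric_aut :=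
  [set U | exists (X : seq M) (e : R), 0 < e /\ metric_aut_nbhd phi X e `<=` U].

HB.instance Definition _ := hasNbhs.Build metric_aut metric_aut_nbhs.

Let aut_nbhs_filter (phi : metric_aut) : ProperFilter (nbhs phi).
Proof.
split.
  by move=> [X [e [e0 h]]]; apply: (h phi) => x _; rewrite adistxx.
split.
- by exists [::], 1; split.
- move=> U V [X [e [e0 XU]]] [Y [d [d0 YV]]].
  exists (X ++ Y), (Num.min e d); split; first by rewrite lt_min e0.
  move=> f fXY; split.
  + apply: XU => x xX; have := fXY x; rewrite mem_cat xX lt_min.
    by move=> /(_ isT)/andP[].
  + apply: YV => x xY; have := fXY x; rewrite mem_cat xY orbT lt_min.
    by move=> /(_ isT)/andP[].
- by move=> U V UV [X [e [e0 XU]]]; exists X, e; split=> // f /XU /UV.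
Qed.

Let aut_nbhs_singleton (phi : metric_aut) (U : set metric_aut) :
  nbhs phi U -> U phi.
Proof. by move=> [X [e [e0 h]]]; apply: h => x _; rewrite adistxx. Qed.

Let aut_nbhs_nbhs (phi : metric_aut) (U : set metric_aut) :
  nbhs phi U -> nbhs phi (nbhs^~ U).
Proof.
move=> [X [e [e0 XU]]]; have e2 : 0 < e / 2 by rewrite divr_gt0.
exists X, (e / 2); split=> // f fX; exists X, (e / 2); split=> // g gX.
apply: XU => x xX; rewrite (le_lt_trans (adist_triangle (f x) _ _))//.
by rewrite (splitr e) ltrD ?gX ?fX.
Qed.

HB.instance Definition _ := Nbhs_isNbhsTopological.Build metric_aut
  aut_nbhs_filter aut_nbhs_singleton aut_nbhs_nbhs.

Let aut_mul_continuous :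
  continuous (fun p : metric_aut * metric_aut => (p.1 * p.2)%g).
Proof.
move=> [f g] U [X [e [e0 XU]]]; have e2 : 0 < e / 2 by rewrite divr_gt0.
exists (metric_aut_nbhd f (map g X) (e / 2), metric_aut_nbhd g X (e / 2)).
  by split=> /=; [exists (map g X), (e / 2); split | exists X, (e / 2); split].
move=> [f' g'] [/= ff' gg']; apply: XU => x xX /=.
rewrite (le_lt_trans (adist_triangle (f' (g x)) _ _))//.
have [_ _ _ ->] := metric_autP f'.
by rewrite (splitr e) ltrD ?gg' ?ff'// map_f.
Qed.

Let aut_inv_continuous : continuous (fun f : metric_aut => (f^-1)%g).
Proof.
move=> f U [X [e [e0 XU]]].
exists (map (f^-1)%g X), e; split=> // g gX; apply: XU => x xX /=.
have [_ _ _ <-] := metric_autP g.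
by rewrite metric_autVK adist_sym -[X in adist _ X](metric_autVK f) gX ?map_f.
Qed.

HB.instance Definition _ := isTopologicalGroup.Build metric_aut
  aut_mul_continuous aut_inv_continuous.

End AutomorphismGroup.

(* This is M(F_q) for the finite field F with q elements; the distance takes its
   values in the model R of the real numbers. *)
Definition rank_completion (F : fieldType) (R : realType) (n : factor_sequence) :
  metricAlgType F R := alg_completion (dirlim F n).

(* Main.v *)
(** The groups GL_{n_k}(F_q) act on M(F_q) by inner automorphisms, and their
    union is dense in Aut(M(F_q)): for an automorphism [phi] and the matrix
    units [E a b] of M_{n_j}(F_q), the element [y = sum_a phi(E a o) z E o a]
    satisfies [phi(x) y = y x] for every x in M_{n_j}(F_q). As [phi] is
    isometric, [phi(E o o)] has the same normalized rank as [E o o], so [z] can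
    be chosen to make [y] nearly invertible; a unit of some M_{n_k}(F_q) close
    to [y] then nearly implements [phi] on M_{n_j}(F_q).

    The groups GL_N(F_q) with the normalized rank metric form a Levy family: a
    function on GL_N(F_q) that is 1-Lipschitz for the rank has variance at most
    4 N, by fixing the rows one at a time, since two consecutive cosets are at
    rank distance at most 2. Hence two sets of proportion at least 1/r contain
    elements at normalized rank distance O(sqrt(r / N)).

    If an action on a compact space had no fixed point, then finitely many open
    sets, each moved off itself by an inner automorphism, would cover the space
    with room for a neighborhood of 1. Pulling the cover back along an orbit
    gives a finite cover of GL_N(F_q) that contradicts concentration. *)

From HB Require Import structures.
Require Import Defs.
From mathcomp Require Import all_boot all_order all_algebra.
From mathcomp Require Import finmap.
From mathcomp Require Import all_classical all_reals topology.
From mathcomp Require Import zify ring lra.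
Set Implicit Arguments.
Unset Strict Implicit.
Unset Printing Implicit Defensive.
Import Order.TTheory GRing.Theory Num.Theory.
Local Open Scope ring_scope.

(** * Concentration of measure on GL_n(F_q) for the rank metric *)

Section Poincare.
Context {F : finFieldType} (n : nat).

(** The stabilizer of the first [i] basis row vectors. These subgroups descend from GL_n at [i = 0]
    to the trivial group at [i = n]. *)
Definition unit_frame i : {set 'M[F]_n} :=
  [set A in unitmx | [forall k : 'I_n, (k < i)%N ==> (row k A == delta_mx 0 k)]].

Lemma unit_frameP i (A : 'M[F]_n) : reflect
  (A \in unitmx /\ forall k : 'I_n, (k < i)%N -> row k A = delta_mx 0 k)
  (A \in unit_frame i).
Proof.
rewrite inE; apply: (iffP andP) => -[Au Ak]; split=> //.
- by move=> k ki; apply/eqP; move/forallP/(_ k)/implyP: Ak; exact.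
- by apply/forallP => k; apply/implyP => ki; rewrite Ak.
Qed.

Lemma unit_frame1 i : 1%:M \in unit_frame i.
Proof. by apply/unit_frameP; split=> [|k _]; rewrite ?unitmx1 ?row1. Qed.

Lemma unit_frame0 : unit_frame 0 = [set A | A \in unitmx].
Proof. by apply/setP => A; rewrite [in RHS]inE; apply/unit_frameP/idP => [[]|]. Qed.

Lemma unit_frame_full : unit_frame n = [set 1%:M].
Proof.
apply/setP => A; rewrite finset.in_set1; apply/idP/eqP => [/unit_frameP[_ Ak]|->]; last first.
  exact: unit_frame1.
by apply/row_matrixP => k; rewrite Ak// row1.
Qed.

Lemma unit_frameM i (A B : 'M[F]_n) :
  A \in unit_frame i -> B \in unit_frame i -> A *m B \in unit_frame i.
Proof.
move=> /unit_frameP[Au Ak] /unit_frameP[Bu Bk]; apply/unit_frameP.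
split=> [|k ki]; first by rewrite unitmx_mul Au.
by rewrite row_mul Ak// -rowE Bk.
Qed.

Lemma unit_frameV i (A : 'M[F]_n) :
  A \in unit_frame i -> invmx A \in unit_frame i.
Proof.
move=> /unit_frameP[Au Ak]; apply/unit_frameP.
split=> [|k ki]; first by rewrite unitmx_inv.
by rewrite rowE -[in LHS](Ak k ki) -row_mul mulmxV// row1.
Qed.

Lemma unit_frameS i (A : 'M[F]_n) (ki : 'I_n) : ki = i :> nat ->
  (A \in unit_frame i.+1) = (A \in unit_frame i) && (row ki A == delta_mx 0 ki).
Proof.
move=> kiE; apply/unit_frameP/andP => [[Au Ak]|[/unit_frameP[Au Ak] /eqP Ai]].
  split; last by apply/eqP; rewrite Ak// kiE.
  by apply/unit_frameP; split=> // k ki'; rewrite Ak// ltnS ltnW.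
split=> // k; rewrite ltnS leq_eqVlt => /orP[/eqP kE|]; last exact: Ak.
by have -> : k = ki by apply/val_inj; rewrite /= kE.
Qed.

(** If row [v] were supported on the first [i] columns, then [v *m A = v], since [A] fixes those
    basis vectors. But [delta_mx 0 i *m A = v] too, so invertibility would force [v = delta_mx 0 i],
    whose entry [i] is not zero. *)
Lemma unit_frame_row (i : 'I_n) (A : 'M[F]_n) : A \in unit_frame i ->
  exists2 j : 'I_n, (i <= j)%N & row i A 0 j != 0.
Proof.
move=> /unit_frameP[Au Ak]; set v := row i A.
case: (pickP (fun j : 'I_n => (i <= j)%N && (v 0 j != 0))) => [j /andP[]|v0].
  by exists j.
have vA : v *m A = v.
  rewrite mulmx_sum_row [RHS]row_sum_delta; apply: eq_bigr => k _.
  have [ki|ik] := ltnP k i; first by rewrite Ak.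
  by have := v0 k; rewrite ik /= => /negbFE/eqP ->; rewrite !scale0r.
have /(congr1 (mulmx^~ (invmx A))) : v *m A = delta_mx 0 i *m A.
  by rewrite vA /v rowE.
rewrite !mulmxK// => vE; have := v0 i.
by rewrite leqnn vE mxE !eqxx oner_eq0.
Qed.

(* [s = 1 + p (v - e_i)] for a column [p] killed by the first rows such that
   [e_i p = 1] and [v p] is nonzero. *)
Lemma unit_frame_lift (i : 'I_n) (v : 'rV[F]_n) :
    (exists2 j : 'I_n, (i <= j)%N & v 0 j != 0) ->
  exists s : 'M[F]_n,
    [/\ s \in unit_frame i, row i s = v & (\rank (s - 1%:M)%R <= 1)%N].
Proof.
move=> [j ij vj]; have [p [pk pi pv]] : exists p : 'cV[F]_n,
    [/\ forall k : 'I_n, (k < i)%N -> p k 0 = 0, p i 0 = 1 & (v *m p) 0 0 != 0].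
  (* The column [p] is e_i if [v] has a nonzero entry at [i], and e_i + e_j otherwise; [i <= j]
     keeps the entries before [i] zero. *)
  have [vi|vi] := eqVneq (v 0 i) 0; last first.
    exists (delta_mx i 0); split=> [k ki||]; rewrite ?mxE ?eqxx//.
      by have /negPf -> : k != i by rewrite -val_eqE neq_ltn ki.
    rewrite (bigD1 i)//= big1 ?addr0 ?mxE ?eqxx ?mulr1// => k ki.
    by rewrite mxE (negPf ki) mulr0.
  have ji : j != i by apply: contraNneq vj => ->; rewrite vi.
  exists (delta_mx i 0 + delta_mx j 0); split=> [k ki||].
  - have /negPf ki' : k != i by rewrite -val_eqE neq_ltn ki.
    have /negPf kj : k != j by rewrite -val_eqE neq_ltn (leq_trans ki ij).
    by rewrite !mxE ki' kj addr0.
  - by rewrite !mxE !eqxx eq_sym (negPf ji) addr0.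
  - rewrite mulmxDr -![_ *m delta_mx _ _]colE !mxE.
    by rewrite vi add0r.
pose w : 'rV[F]_n := v - delta_mx 0 i; pose s := 1%:M + p *m w.
have rowp k : row k (p *m w) = p k 0 *: w.
  rewrite row_mul [row k p]mx11_scalar mul_scalar_mx; congr (_ *: _).
  by rewrite mxE.
have wp : w *m p = ((v *m p) 0 0 - 1)%:M.
  have -> : w *m p = v *m p - 1%:M.
    rewrite mulmxBl -rowE; congr (_ - _).
    by rewrite [row i p]mx11_scalar; congr _%:M; rewrite mxE.
  by rewrite [v *m p in LHS]mx11_scalar raddfB.
(* As [Q *m Q = (t - 1) *: Q], the matrix 1 - t^-1 Q inverts [s = 1 + Q]. *)
have su : s \in unitmx.
  set t := (v *m p) 0 0 in pv wp *; set Q := p *m w.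
  have QQ : Q *m Q = (t - 1) *: Q.
    by rewrite /Q mulmxA -(mulmxA p w p) wp mul_mx_scalar -scalemxAl.
  apply: (@mulmx1_unit _ _ s (1%:M - t^-1 *: Q) _).1.
  have sQ : s *m Q = t *: Q.
    by rewrite mulmxDl mul1mx QQ scalerBl scale1r addrC subrK.
  by rewrite mulmxBr mulmx1 -scalemxAr sQ scalerA mulVf// scale1r addrK.
exists s; split.
- apply/unit_frameP; split=> // k ki.
  by rewrite raddfD /= rowp pk// scale0r addr0 row1.
- by rewrite raddfD /= rowp pi scale1r row1 /w addrC subrK.
- by rewrite /s addrC addKr (leq_trans (mxrankM_maxl _ _))// rank_leq_col.
Qed.


(** Row [i] partitions [unit_frame i], and its fiber over [v] is the right coset of
    [unit_frame i.+1] through [s v]. *)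
Lemma sum_unit_frame (R : nmodType) (i : 'I_n) (V : {set 'rV[F]_n})
    (s : 'rV[F]_n -> 'M[F]_n) (g : 'M[F]_n -> R) :
  (forall A, A \in unit_frame i -> row i A \in V) ->
  (forall v, v \in V -> s v \in unit_frame i /\ row i (s v) = v) ->
  \sum_(A in unit_frame i) g A =
  \sum_(v in V) \sum_(h in unit_frame i.+1) g (h *m s v).
Proof.
move=> rowV sV; rewrite (partition_big (row i) (mem V))//=.
apply: eq_bigr => v /sV[si sv]; have /unit_frameP[su _] := si.
rewrite (reindex_onto (mulmx^~ (s v)) (mulmx^~ (invmx (s v)))) /=; last first.
  by move=> A _; rewrite mulmxKV.
apply: eq_bigl => h; rewrite mulmxK// eqxx andbT (@unit_frameS _ _ i)//.
apply/andP/andP => -[hi /eqP hv]; split.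
- by rewrite -[h](mulmxK su) unit_frameM ?unit_frameV.
- apply/eqP/(can_inj (mulmxK su)).
  by rewrite -row_mul hv -rowE sv.
- exact: unit_frameM.
- by rewrite row_mul hv -rowE sv.
Qed.

Section Variance.
Context {R : realFieldType}.

Lemma sum_norm_le (T : finType) (S : {set T}) (g : T -> R) c :
  (forall x, x \in S -> `|g x| <= c) -> `|\sum_(x in S) g x| <= c * #|S|%:R.
Proof.
move=> gc; rewrite (le_trans (ler_norm_sum _ _ _))//.
by rewrite mulr_natr -sumr_const ler_sum.
Qed.

Definition mean (T : finType) (S : {set T}) (g : T -> R) : R :=
  (\sum_(x in S) g x) / #|S|%:R.

Lemma meanK (T : finType) (S : {set T}) (g : T -> R) : (0 < #|S|)%N ->
  \sum_(x in S) g x = mean S g * #|S|%:R.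
Proof. by move=> S0; rewrite divfK// pnatr_eq0 -lt0n. Qed.

(** Deviations from the mean sum to zero, which kills the cross term. *)
Lemma sum_sqr_mean (T : finType) (S : {set T}) (g : T -> R) c : (0 < #|S|)%N ->
  \sum_(x in S) (g x - c) ^+ 2 =
  \sum_(x in S) (g x - mean S g) ^+ 2 + (mean S g - c) ^+ 2 * #|S|%:R.
Proof.
move=> S0; set m := mean S g.
have -> : \sum_(x in S) (g x - c) ^+ 2 = \sum_(x in S)
    ((g x - m) ^+ 2 + (m - c) ^+ 2 + (m - c) *+ 2 * (g x - m)).
  by apply: eq_bigr => x _; rewrite mulrnAl -mulrnAr; lra.
have g0 : \sum_(x in S) (g x - m) = 0.
  by rewrite sumrB (meanK g S0) sumr_const -[m *+ _]mulr_natr subrr.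
by rewrite !big_split/= -[X in _ + X]mulr_sumr g0 mulr0 addr0 sumr_const mulr_natr.
Qed.

Lemma dist_mean_le (T : finType) (S : {set T}) (g : T -> R) c x :
  x \in S -> (forall y, y \in S -> `|g x - g y| <= c) ->
  `|g x - mean S g| <= c.
Proof.
move=> xS gc; have S0 : (0 < #|S|)%N by apply/card_gt0P; exists x.
have S0r : 0 < #|S|%:R :> R by rewrite ltr0n.
rewrite -(ler_pM2r S0r) -[X in `|_| * X]ger0_norm// -normrM mulrBl -meanK//.
by rewrite mulr_natr -sumr_const -sumrB sum_norm_le.
Qed.

Definition rank_lipschitz (f : 'M[F]_n -> R) :=
  forall A B, `|f A - f B| <= (\rank (A - B))%:R.

Lemma mean_dist_le (T : finType) (S : {set T}) (g h : T -> R) c :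
  (0 < #|S|)%N -> (forall x, x \in S -> `|g x - h x| <= c) ->
  `|mean S g - mean S h| <= c.
Proof.
move=> S0 ghc; have S0r : 0 < #|S|%:R :> R by rewrite ltr0n.
rewrite -(ler_pM2r S0r) -[X in `|_| * X]ger0_norm// -normrM mulrBl -!meanK//.
by rewrite -sumrB sum_norm_le.
Qed.

(** Induction on the number [d] of free rows, by the law of total variance over the cosets of
    [unit_frame i.+1] in [unit_frame i]. The variance inside each coset is bounded by induction;
    that of the coset means [mu] adds at most 4, since they differ by at most 2. *)
Lemma unit_frame_variance d (f : 'M[F]_n -> R) :
  (d <= n)%N -> rank_lipschitz f ->
  \sum_(A in unit_frame (n - d)) (f A - mean (unit_frame (n - d)) f) ^+ 2 <=
  (4 * d)%:R * #|unit_frame (n - d)|%:R.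
Proof.
elim: d f => [|d IHd] f dn f_lip.
  rewrite subn0 unit_frame_full /mean !big_set1 cards1 divr1 subrr.
  by rewrite expr0n mulr_ge0.
have i_lt : (n - d.+1 < n)%N by lia.
pose i := Ordinal i_lt; have iE : (n - d = i.+1)%N by rewrite /=; lia.
rewrite -[(n - d.+1)%N]/(nat_of_ord i); set m := mean _ f.
have {IHd} IHd g : rank_lipschitz g ->
    \sum_(A in unit_frame i.+1) (g A - mean (unit_frame i.+1) g) ^+ 2 <=
    (4 * d)%:R * #|unit_frame i.+1|%:R.
  by move=> g_lip; rewrite -iE IHd// ltnW.
pose P v s := [&& s \in unit_frame i, row i s == v & (\rank (s - 1%:M)%R <= 1)%N].
(* Coset representatives within rank 1 of the identity, supplied by [unit_frame_lift]; the default
   is never reached for [v] in [V]. *)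
pose s v := odflt 1%:M [pick s | P v s].
pose V := [set row i A | A in unit_frame i].
have sP v : v \in V -> P v (s v).
  move=> /imsetP[A /unit_frame_row/unit_frame_lift[t [ti tv t1]] vE].
  rewrite /s; case: pickP => [//|/(_ t)]; first by rewrite /P ti tv vE eqxx t1.
have rowV A : A \in unit_frame i -> row i A \in V by exact: imset_f.
have sV v : v \in V -> s v \in unit_frame i /\ row i (s v) = v.
  by move=> /sP/and3P[-> /eqP ->].
set H := unit_frame i.+1 in IHd.
have H0 : (0 < #|H|)%N by apply/card_gt0P; exists 1%:M; exact: unit_frame1.
have cardE : #|unit_frame i|%:R = #|H|%:R * #|V|%:R :> R.
  have := sum_unit_frame (fun=> 1 : R) rowV sV.
  by rewrite !sumr_const !mulr_natr => ->.
pose mu v := mean H (fun h => f (h *m s v)).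
(* All cosets have the same size, so the coset means carry equal weights. *)
have mE : m = mean V mu.
  rewrite /m /mean cardE (sum_unit_frame f rowV sV) invfM mulrA.
  by rewrite mulr_suml.
(* The cosets are paired by [h *m s v] and [h *m s w], at rank distance at most 2 because [s v] and
   [s w] are both within rank 1 of [1%:M]. *)
have mu_dist v w : v \in V -> w \in V -> `|mu v - mu w| <= 2.
  move=> /sP/and3P[_ _ v1] /sP/and3P[_ _ w1].
  apply: mean_dist_le => // h _; rewrite (le_trans (f_lip _ _))// ler_nat.
  rewrite -mulmxBr (leq_trans (mxrankM_maxr _ _))//.
  rewrite -[s v - s w](subrKA 1%:M) (leq_trans (mxrank_add _ _))//.
  by rewrite (@leq_add _ _ 1 1)// -opprB mxrank_opp.
rewrite (sum_unit_frame _ rowV sV) cardE.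
rewrite [leRHS]mulrA mulr_natr -sumr_const ler_sum// => v vV.
rewrite sum_sqr_mean// -/(mu v) mulnS addnC natrD mulrDl lerD//.
  apply: (IHd (fun h => f (h *m s v))) => A B; rewrite (le_trans (f_lip _ _))//.
  by rewrite ler_nat -mulmxBl mxrankM_maxl.
rewrite ler_wpM2r// -real_normK ?num_real// (_ : 4%:R = 2 ^+ 2); last first.
  by rewrite -natrX.
rewrite lerXn2r// ?nnegrE// mE; apply: dist_mean_le => // w; exact: mu_dist.
Qed.

Lemma unitmx_variance (f : 'M[F]_n -> R) : rank_lipschitz f -> exists c,
  \sum_(A in unitmx) (f A - c) ^+ 2 <= (4 * n)%:R * #|[set A : 'M[F]_n | A \in unitmx]|%:R.
Proof.
move=> /(unit_frame_variance (leqnn n)); rewrite subnn unit_frame0.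
set c := mean _ _ => h; exists c; rewrite (le_trans _ h)//.
by under [leRHS]eq_bigl do rewrite inE.
Qed.

(** Chebyshev's inequality for the distance to [A]. If [B] were farther than [e * n] from [A], this
    distance would deviate from [c] by at least [e * n / 2] on all of [A] or on all of [B],
    according to the size of [c]. *)
Lemma unitmx_concentration (A B : {set 'M[F]_n}) (r : nat) (e : R) :
  A \subset unitmx -> B \subset unitmx ->
  (#|[set C : 'M[F]_n | C \in unitmx]| <= r * #|A|)%N ->
  (#|[set C : 'M[F]_n | C \in unitmx]| <= r * #|B|)%N ->
  0 < e -> (16 * r)%:R < e ^+ 2 * n%:R ->
  exists a b, [/\ a \in A, b \in B & (\rank (a - b))%:R <= e * n%:R].
Proof.
move=> AU BU; set N := #|[set C | _]| => NA NB e0 rn.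
have N0 : (0 < N)%N by apply/card_gt0P; exists 1%:M; rewrite inE unitmx1.
have n0 : 0 < n%:R :> R.
  rewrite ltr0n lt0n; apply: contraTneq rn => ->.
  by rewrite mulr0 -leNgt ler0n.
have [a0 a0A] : exists a0, a0 \in A.
  by apply/card_gt0P; move: (leq_trans N0 NA); rewrite muln_gt0 => /andP[].
pose f (C : 'M[F]_n) := [arg min_(a < a0 in A) \rank (C - a)%R].
have f_in C : f C \in A by rewrite /f; case: arg_minnP.
have f_min C a : a \in A -> (\rank (C - f C)%R <= \rank (C - a)%R)%N.
  by rewrite /f; case: arg_minnP => // b bA h /h.
have f_le C D : (\rank (C - f C)%R <= \rank (C - D)%R + \rank (D - f D)%R)%N.
  rewrite (leq_trans (f_min C _ (f_in D)))// -[C - f D](subrKA D).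
  exact: mxrank_add.
have [|c hc] := @unitmx_variance (fun C => (\rank (C - f C))%:R).
  move=> C D /=; have := f_le D C; rewrite -[D - C]opprB mxrank_opp.
  have := f_le C D; rewrite -!(ler_nat R) !natrD => h h'.
  by rewrite ler_norml; apply/andP; split; lra.
(* Such a deviation on [S] gives (e n / 2)^2 |S| <= 4 n N <= 4 n r |S|, hence e^2 n <= 16 r, against
   the hypothesis on [n]. *)
have lower (S : {set 'M[F]_n}) : S \subset unitmx -> (N <= r * #|S|)%N ->
    ~ (forall C, C \in S -> (e * n%:R / 2) ^+ 2 <= ((\rank (C - f C))%:R - c) ^+ 2).
  move=> SU NS h.
  have S0 : 0 < #|S|%:R :> R.
    by rewrite ltr0n; move: (leq_trans N0 NS); rewrite muln_gt0 => /andP[].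
  have : (e * n%:R / 2) ^+ 2 * #|S|%:R <= (4 * n)%:R * (r * #|S|)%:R.
    rewrite mulr_natr -sumr_const (le_trans (ler_sum _ h))//.
    apply: (@le_trans _ _ ((4 * n)%:R * N%:R)); last first.
      by rewrite ler_wpM2l// ler_nat.
    apply: le_trans hc; rewrite [leRHS](bigID (mem S))/=.
    rewrite -[leLHS]addr0 lerD ?sumr_ge0//; last by move=> i _; exact: sqr_ge0.
    rewrite le_eqVlt; apply/orP; left; apply/eqP/eq_bigl => C; apply/idP/andP => [CS|[]//].
    by split=> //; exact: (fintype.subsetP SU).
  rewrite !natrM mulrA ler_pM2r// leNgt => /negP; apply.
  have -> : (e * n%:R / 2) ^+ 2 = (e ^+ 2 * n%:R) * (n%:R / 4) by field.
  have -> : 4 * n%:R * r%:R = (16 * r)%:R * (n%:R / 4) :> R by rewrite natrM; field.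
  by rewrite ltr_pM2r ?divr_gt0.
apply: contrapT => no.
have far b : b \in B -> e * n%:R < (\rank (b - f b))%:R.
  move=> bB; rewrite ltNge; apply/negP => h; apply: no.
  by exists (f b), b; rewrite f_in bB -opprB mxrank_opp.
have en0 : 0 <= e * n%:R / 2 by rewrite divr_ge0 ?mulr_ge0// ltW.
have [cl|cs] := lerP (e * n%:R / 2) `|c|.
  apply: (lower A AU NA) => a aA.
  have -> : \rank (a - f a) = 0%N.
    by apply/eqP; rewrite -leqn0 (leq_trans (f_min a a aA))// subrr mxrank0.
  by rewrite sub0r sqrrN -[leRHS]real_normK ?num_real// lerXn2r// nnegrE.
apply: (lower B BU NB) => b /far fb.
move: cs; rewrite ltr_norml => /andP[_ cs].
by rewrite lerXn2r// ?nnegrE//; lra.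
Qed.

End Variance.
End Poincare.

(** * A fixed-point criterion through finite covers of the group *)

Section FixedPoint.
Local Open Scope classical_set_scope.

(* The library's [compact_cover] is restricted to pointed types. *)
Lemma compact_cover_setT (X : topologicalType) (x0 : X) :
  compact [set: X] -> cover_compact [set: X].
Proof.
pose pX := HB.pack_for ptopologicalType X (isPointed.Build X x0).
by move=> cX; have : @compact pX setT := cX; rewrite compact_cover.
Qed.

(** The hypothesis on covers says that some translate [h i A i] meets [W A i]. Without fixed points,
    compactness yields finitely many [V] covering [X], each with some [g] in [D] moving a larger set
    [U] off itself, where [W V] lies in [U]. Pulled back along the orbit of [x0], they violate the
    hypothesis: [h a = w b] puts both [a x0] and its image under [h] in [U]. *)
Lemma extremely_amenable_finite_cover (G : topGroupType) (D : set G) :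
  dense D ->
  (forall (W : set G) (I : finType) (A : I -> set G) (h : I -> G),
    nbhs 1%g W -> (forall g, exists i, A i g) -> (forall i, D (h i)) ->
    exists i a b w, [/\ A i a, A i b, W w & (h i * a = w * b)%g]) ->
  extremely_amenable G.
Proof.
move=> dD cover X act cX hX [x0 _] [act1 actM actC].
apply: contrapT => /forallNP nofix.
have act_cl (g : G) : continuous (act g).
  move=> x; apply: (@continuous_comp _ _ _ (fun x => (g, x)) (fun p => act p.1 p.2)).
    exact: cvg_pair (cvg_cst _) cvg_id.
  exact: actC.
have act_cr (x : X) : continuous (act^~ x).
  move=> g; apply: (@continuous_comp _ _ _ (fun g => (g, x)) (fun p => act p.1 p.2)).
    exact: cvg_pair cvg_id (cvg_cst _).
  exact: actC.
(* Moving [x] is an open condition on [g], because points of a Hausdorff space are closed; density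
   then provides such a [g] in [D]. *)
have movedD x : exists2 g, D g & act g x != x.
  have /existsNP[g0 g0x] := nofix x.
  have oN : open [set g | act g x != x].
    rewrite (_ : [set _ | _] = act^~ x @^-1` (~` [set x])); last first.
      by apply/seteqP; split=> g /= /eqP.
    apply: open_comp => [g _|]; first exact: act_cr.
    by rewrite openC; exact/accessible_closed_set1/hausdorff_accessible.
  have [|g [gx Dg]] := dD _ _ oN; first by exists g0; apply/eqP.
  by exists g.
have locP x : exists p : G * (set X * (set G * set X)), 
    let: (g, (U, (W, V))) := p in
    [/\ D g, nbhs 1%g W, open_nbhs x V,
      forall w y, W w -> V y -> U (act w y) &
      forall y, U y -> ~ U (act g y)].
  have [g Dg gx] := movedD x.
  have := hX; rewrite open_hausdorff => /(_ _ _ gx)[[P Q] /= [Px Qx] [oP oQ /eqP PQ]].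
  rewrite !inE in Px Qx.
  (* The image of [U] under [g] lies in [P], which is disjoint from [Q] and so from [U]. *)
  pose U := Q `&` act g @^-1` P.
  have nU : nbhs x U.
    by apply: filterI; [exact: open_nbhs_nbhs|apply: act_cl; exact: open_nbhs_nbhs].
  have /= := actC (1%g, x) U; rewrite act1 => /(_ nU)[[W V] /= [nW nV] WVU].
  exists (g, (U, (W, V^°))); split=> //.
  - by split; [exact: open_interior|].
  - by move=> w y Ww /interior_subset Vy; exact: (WVU (w, y)).
  - move=> y [_ Py] [Qy _].
    by have : (P `&` Q) (act g y) by []; rewrite PQ.
have [loc {}locP] := choice locP.
have /(_ _ setT (fun x => (loc x).2.2.2)) [] := compact_cover_setT x0 cX.
- by move=> x _; have := locP x; case: (loc x) => g [U [W V]] [_ _ []].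
- move=> x _; exists x => //; have := locP x.
  by case: (loc x) => g [U [W V]] [_ _ []].
move=> I _ XI; pose W := \bigcap_(x in [set` I]) (loc x).2.2.1.
have [|g||i [a [b [w [Aa Ab Ww hab]]]]] := cover W I
    (fun i => [set g | (loc (val i)).2.2.2 (act g x0)]) (fun i => (loc (val i)).1).
- apply: filter_bigI => x xI; have := locP x.
  by case: (loc x) => g [U [W' V]] [].
- have [x xI xg] := XI (act g x0) Logic.I.
  by exists [` xI]%fset.
- by move=> i; have := locP (val i); case: (loc (val i)) => g [U [W' V]] [].
have := Ww (val i) (valP i); move: Aa Ab hab => /=.
have := locP (val i); case: (loc (val i)) => g [U [W' V]] [_ nW' oV WV gU] /= Va Vb hab W'w.
have W'1 : W' 1%g by exact: nbhs_singleton.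
apply: (gU (act a x0)); first by rewrite -(act1 (act a x0)); exact: WV.
by rewrite -actM hab actM; exact: WV.
Qed.

End FixedPoint.

(** * Compression and approximation by invertible matrices, measured by rank *)

Section MatrixRank.
Context {F : fieldType} (n : nat).

Lemma rank_pid_mxB p d : (\rank (pid_mx (p + d) - pid_mx p : 'M[F]_n)%R <= d)%N.
Proof.
elim: d => [|d IHd]; first by rewrite addn0 subrr mxrank0.
rewrite -[X in \rank X](subrKA (pid_mx (p + d))) (leq_trans (mxrank_add _ _))//.
rewrite (@leq_add _ _ 1 d)// addnS.
have [pd|pd] := ltnP (p + d) n; last first.
  rewrite (_ : _ - _ = 0) ?mxrank0//; apply/matrixP => i j; rewrite !mxE.
  have /= iN := leq_trans (ltn_ord i) pd.
  by rewrite iN ltnS ltnW// subrr.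
pose i0 := Ordinal pd; rewrite (_ : _ - _ = delta_mx i0 i0) ?mxrank_delta//.
apply/matrixP => i j; rewrite !mxE -!val_eqE /= ltnS.
have [/eqP ->|ij] /= := boolP (i == j :> nat).
  by rewrite andbb leq_eqVlt; case: ltngtP; rewrite /= ?subr0 ?subrr.
rewrite subrr; case: eqP => //= iE; case: eqP => //= jE.
by rewrite iE jE eqxx in ij.
Qed.

(** Base changes bring [P] and [Q] to the normal form [pid_mx], so the error is a difference of two
    partial identities. One of the two truncated differences is zero, so their sum is the absolute
    difference of the ranks. *)
Lemma rank_compress (P Q : 'M[F]_n) : exists Z' Z : 'M[F]_n,
  (\rank (Z' *m P *m Z - Q)%R <=
    (\rank P - \rank Q) + (\rank Q - \rank P))%N.
Proof.
exists (col_ebase Q *m invmx (col_ebase P)), (invmx (row_ebase P) *m row_ebase Q).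
set p := \rank P; set q := \rank Q.
have -> : col_ebase Q *m invmx (col_ebase P) *m P *m
    (invmx (row_ebase P) *m row_ebase Q) - Q =
    col_ebase Q *m (pid_mx p - pid_mx q) *m row_ebase Q.
  rewrite mulmxBr mulmxBl mulmx_ebase; congr (_ - _).
  rewrite -[X in _ *m X *m (_ *m _)](mulmx_ebase P) !mulmxA.
  by rewrite mulmxKV ?col_ebase_unit// mulmxK ?row_ebase_unit.
rewrite (leq_trans (mxrankM_maxl _ _))// (leq_trans (mxrankM_maxr _ _))//.
have [pq|/ltnW qp] := leqP p q.
- rewrite -opprB mxrank_opp -{1}(subnKC pq) (leq_trans (rank_pid_mxB _ _))//.
  exact: leq_addl.
- rewrite -{1}(subnKC qp) (leq_trans (rank_pid_mxB _ _))//.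
  exact: leq_addr.
Qed.

(** Replacing the partial identity by the full one in the normal form of [Y] changes it by a matrix
    whose rank is at most the corank of [Y]. *)
Lemma near_unitmx (Y : 'M[F]_n) : exists2 g : 'M[F]_n,
  g \in unitmx & (\rank (g - Y)%R + \rank Y <= n)%N.
Proof.
exists (col_ebase Y *m row_ebase Y).
  by rewrite unitmx_mul col_ebase_unit row_ebase_unit.
have -> : col_ebase Y *m row_ebase Y - Y =
    col_ebase Y *m copid_mx (\rank Y) *m row_ebase Y.
  by rewrite mulmxBr mulmx1 mulmxBl mulmx_ebase.
rewrite addnC -leq_subRL ?rank_leq_row// (leq_trans (mxrankM_maxl _ _))//.
rewrite (leq_trans (mxrankM_maxr _ _))// rank_copid_mx ?rank_leq_row//.
Qed.

Lemma near_unitmx_of_mul (Y' Y : 'M[F]_n) : exists2 g : 'M[F]_n,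
  g \in unitmx & (\rank (g - Y)%R <= \rank (Y' *m Y - 1%:M)%R)%N.
Proof.
have [g gu gY] := near_unitmx Y; exists g => //.
rewrite -(leq_add2r (\rank Y)) (leq_trans gY)//.
rewrite -{1}(mxrank1 F n) -[X in (\rank X <= _)%N](subKr (Y' *m Y)).
rewrite (leq_trans (mxrank_add _ _))// mxrank_opp addnC leq_add//.
exact: mxrankM_maxr.
Qed.

End MatrixRank.

(** * Distance estimates in a metric algebra *)

Section MetricAlgebra.
Context {F : fieldType} {R : realType} (A : metricAlgType F R).
Implicit Types x y u v : A.

Lemma adist_sum (I : Type) (r : seq I) (f g : I -> A) :
  adist (\sum_(i <- r) f i) (\sum_(i <- r) g i) <= \sum_(i <- r) adist (f i) (g i).
Proof.
elim/big_rec3: _ => [|i a x y _ xy]; first by rewrite adistxx.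
by rewrite (le_trans (adistD_lip _ _ _ _))// lerD2l.
Qed.

Lemma adist_lip x y z : `|adist x z - adist y z| <= adist x y.
Proof.
have := adist_triangle y x z; have := adist_triangle x y z.
by rewrite [adist y x]adist_sym ler_norml => h1 h2; apply/andP; split; lra.
Qed.

Lemma adistMr_unit u v x y : u * v = 1 -> adist (x * u) (y * u) = adist x y.
Proof.
move=> uv; apply/le_anti; rewrite adistMr /=.
by rewrite -{1}[x]mulr1 -{1}[y]mulr1 -uv !mulrA adistMr.
Qed.

Lemma adistMl_unit u v x y : u * v = 1 -> adist (v * x) (v * y) = adist x y.
Proof.
move=> uv; apply/le_anti; rewrite adistMl /=.
by rewrite -{1}[x]mul1r -{1}[y]mul1r -uv -!mulrA adistMl.
Qed.

Lemma is_metric_aut_conj u v : u * v = 1 -> v * u = 1 ->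
  is_metric_aut (fun x => u * x * v).
Proof.
move=> uv vu; split.
- exists (fun x => v * x * u) => x.
  + by rewrite !mulrA vu mul1r -mulrA vu mulr1.
  + by rewrite !mulrA uv mul1r -mulrA uv mulr1.
- by move=> a x y; rewrite mulrDr mulrDl -scalerAr -scalerAl.
- split; first by rewrite mulr1.
  by move=> x y; rewrite !mulrA -[u * x * v * u]mulrA vu mulr1.
- by move=> x y; rewrite (adistMr_unit _ _ vu) (adistMl_unit _ _ vu).
Qed.

Lemma adist_conj_le u v x : u * v = 1 -> v * u = 1 ->
  adist (u * x * v) x <= 2 * adist u 1.
Proof.
move=> uv vu; rewrite -(adistMr_unit _ _ uv) -mulrA vu mulr1.
have := adist_triangle x (u * x) (x * u).
have := adistMr x u 1; have := adistMl x 1 u.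
by rewrite mul1r mulr1 [adist 1 _]adist_sym; lra.
Qed.

(** Compression by the idempotent [e] is nonexpansive and fixes [e]. The intended case is
    [e = E o o], [f = phi (E o o)], and [p] a matrix approximating [f]. *)
Lemma adist_idem_le (e p f z' z : A) : e * e = e ->
  adist (e * z' * f * z * e) e <= adist f p + adist (z' * p * z) e.
Proof.
move=> ee.
have h w w' : adist (e * w * e) (e * w' * e) <= adist w w'.
  exact: le_trans (adistMr _ _ _) (adistMl _ _ _).
have -> : e * z' * f * z * e = e * (z' * f * z) * e by rewrite !mulrA.
have eee : e * e * e = e by rewrite !ee.
rewrite -[X in adist _ X]eee (le_trans (h _ _))//.
rewrite (le_trans (adist_triangle (z' * p * z) _ _))// lerD2r.
exact: le_trans (adistMr _ _ _) (adistMl _ _ _).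
Qed.

Lemma adist_mul1_le (x y x' y' : A) :
  adist (x' * y') 1 <= adist x x' + adist y y' + adist (x * y) 1.
Proof.
rewrite (le_trans (adist_triangle (x * y) _ _))// lerD2r adist_sym.
exact: adistM_lip.
Qed.

(** Right multiplication by the unit [u] preserves distances, so it suffices to compare [x' * u]
    with [u * x]; each is within [adist u y] of [x' * y = y * x]. *)
Lemma adist_intertwine_le u v x x' y : u * v = 1 -> v * u = 1 ->
  x' * y = y * x -> adist x' (u * x * v) <= 2 * adist u y.
Proof.
move=> uv vu xy; rewrite -(adistMr_unit _ _ uv) -mulrA vu mulr1.
have := adist_triangle (x' * y) (x' * u) (u * x).
have := adistMl x' u y; have := adistMr x y u.
by rewrite xy [adist y u]adist_sym; lra.
Qed.

End MetricAlgebra.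

(** * Intertwiners built from matrix units *)

Section Intertwiner.
Context {F : fieldType} {R : realType} (A : metricAlgType F R).
Context (phi : metric_aut A) (m : nat) (E : 'I_m -> 'I_m -> A) (o : 'I_m).
Hypothesis EE : forall a b c d, E a b * E c d = E a d *+ (b == c).
Hypothesis sumE : \sum_a E a a = 1.

Let phiM : {morph phi : x y / x * y}.
Proof. by have [_ _ [_ h] _] := metric_autP phi. Qed.

Let phi0 : phi 0 = 0.
Proof.
have [_ h _ _] := metric_autP phi.
by have := h (-1) 0 0; rewrite scaleN1r oppr0 addr0 scaleN1r addNr.
Qed.

Let EE1 a b c : E a b * E b c = E a c.
Proof. by rewrite EE eqxx. Qed.

(** The Skolem-Noether element for [phi] and the identity. It intertwines exactly for every [z],
    which stays free to make it nearly invertible. *)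
Definition intertwiner z : A := \sum_a phi (E a o) * z * E o a.

Lemma intertwinerP z a b :
  phi (E a b) * intertwiner z = intertwiner z * E a b.
Proof.
rewrite mulr_sumr mulr_suml (bigD1 b)//= [RHS](bigD1 a)//=.
rewrite -!mulrA EE1 mulrA -phiM EE1 !big1 ?addr0// => c.
- by rewrite eq_sym => /negPf ca; rewrite -!mulrA EE eq_sym ca !mulr0.
- by rewrite eq_sym => /negPf cb; rewrite !mulrA -phiM EE cb phi0 !mul0r.
Qed.

(** The same element with [phi] and the identity exchanged, meant as a near left inverse of
    [intertwiner]. *)
Definition cointertwiner z : A := \sum_a E a o * z * phi (E o a).

(** Cross terms vanish, since [phi] turns [E o a * E b o = 0] into the same relation between images.
    The [m] remaining terms are compared one by one with those of 1 = sum_a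
    [E a o * E o o * E o a]. *)
Lemma cointertwiner_mul z' z : adist (cointertwiner z' * intertwiner z) 1 <=
  m%:R * adist (E o o * z' * phi (E o o) * z * E o o) (E o o).
Proof.
have -> : cointertwiner z' * intertwiner z = \sum_a E a o *
    (E o o * z' * phi (E o o) * z * E o o) * E o a.
  rewrite mulr_suml; apply: eq_bigr => a _; rewrite mulr_sumr (bigD1 a)//=.
  rewrite big1 ?addr0 => [|b ba].
    rewrite !mulrA EE1 -[_ * phi _ * phi _]mulrA -phiM EE1.
    by rewrite -[X in _ = X]mulrA EE1.
  rewrite !mulrA -[_ * phi _ * phi _]mulrA -phiM EE eq_sym (negPf ba).
  by rewrite phi0 mulr0 !mul0r.
have s1 : 1 = \sum_a E a o * E o o * E o a.
  by rewrite -sumE; apply: eq_bigr => a _; rewrite !EE1.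
rewrite [X in adist _ X]s1.
rewrite (le_trans (adist_sum _ _ _))// mulr_natl -[X in _ *+ X]card_ord -sumr_const.
by rewrite ler_sum// => a _; rewrite (le_trans (adistMr _ _ _))// adistMl.
Qed.

End Intertwiner.


(** * Inner automorphisms from the matrix levels and their density *)

Section Levels.
Context {F : fieldType} {R : realType} {n : factor_sequence}.
Local Notation M := (rank_completion F R n).

Definition level k (x : 'M[F]_(n k)) : M :=
  to_alg_completion (to_dirlim x : dirlim F n).

Lemma level_is_linear k : linear (@level k).
Proof.
move=> a x y; rewrite /level -to_alg_completion_is_linear.
by rewrite -to_dirlimZ -to_dirlimD.
Qed.

HB.instance Definition _ k := GRing.isLinear.Build F 'M[F]_(n k) M _ (@level k) (@level_is_linear k).

Lemma levelZ k a (x : 'M[F]_(n k)) : level (a *: x) = a *: level x.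
Proof. exact: linearZ_LR. Qed.

Lemma level0 k : level (0 : 'M[F]_(n k)) = 0.
Proof. exact: raddf0. Qed.

Lemma levelM k (x y : 'M[F]_(n k)) : level (x *m y) = level x * level y.
Proof.
by rewrite /level to_dirlimM (to_alg_completion_is_monoid_morphism _).2.
Qed.

Lemma level1 k : level (1%:M : 'M[F]_(n k)) = 1.
Proof.
by rewrite /level to_dirlim1 (to_alg_completion_is_monoid_morphism _).1.
Qed.

Lemma level_isometry k (x y : 'M[F]_(n k)) :
  adist (level x) (level y) = rank_dist R x y.
Proof. by rewrite [LHS]to_alg_completion_isometry to_dirlim_isometry. Qed.

Lemma level_iota k l (x : 'M[F]_(n k)) : (k <= l)%N ->
  level (iota_mx _ (n l) x) = level x.
Proof. by move=> kl; rewrite /level to_dirlim_iota. Qed.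

Lemma level_dense (x : M) (e : R) : 0 < e ->
  exists k (u : 'M[F]_(n k)), adist x (level u) < e.
Proof.
move=> /(to_alg_completion_dense x)[y]; have [k [u ->]] := dirlimW y.
by exists k, u.
Qed.

(** The default value lets conjugation be defined for every matrix [g], with its usual meaning when
    [g] is invertible. *)
Definition unit_part m (g : 'M[F]_m) := if g \in unitmx then g else 1%:M.

Lemma unit_part_unit m (g : 'M[F]_m) : unit_part g \in unitmx.
Proof. by rewrite /unit_part; case: ifP => // _; exact: unitmx1. Qed.

Lemma is_metric_aut_inner k (g : 'M[F]_(n k)) : is_metric_aut
  (fun x : M => level (unit_part g) * x * level (invmx (unit_part g))).
Proof.
apply: is_metric_aut_conj; rewrite -levelM.
- by rewrite mulmxV ?unit_part_unit// level1.
- by rewrite mulVmx ?unit_part_unit// level1.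
Qed.

Definition inner k (g : 'M[F]_(n k)) : metric_aut M :=
  mk_metric_aut (is_metric_aut_inner g).

Lemma innerE k (g : 'M[F]_(n k)) x : g \in unitmx ->
  inner g x = level g * x * level (invmx g).
Proof. by move=> gu; rewrite /= /unit_part gu. Qed.

Lemma level_mulV k (g : 'M[F]_(n k)) : g \in unitmx ->
  level g * level (invmx g) = 1.
Proof. by move=> gu; rewrite -levelM mulmxV// level1. Qed.

Lemma level_Vmul k (g : 'M[F]_(n k)) : g \in unitmx ->
  level (invmx g) * level g = 1.
Proof. by move=> gu; rewrite -levelM mulVmx// level1. Qed.

Lemma innerM k (g h : 'M[F]_(n k)) : g \in unitmx -> h \in unitmx ->
  inner (g *m h) = (inner g * inner h)%g.
Proof.
move=> gu hu; apply: metric_aut_eq => x.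
have ghu : g *m h \in unitmx by rewrite unitmx_mul gu.
rewrite metric_autM !innerE// !mulrA -levelM -[RHS]mulrA -levelM.
congr (_ * level _); apply: (can_inj (mulmxK ghu)).
by rewrite mulVmx// mulmxA mulmxKV// mulVmx.
Qed.

Lemma inner_iota k l (g : 'M[F]_(n k)) : (k <= l)%N -> g \in unitmx ->
  inner (iota_mx _ (n l) g) = inner g.
Proof.
move=> kl gu; apply: metric_aut_eq => x.
have giu : iota_mx _ (n l) g \in unitmx by rewrite iota_mx_unit ?fs_dvd.
rewrite !innerE// level_iota//; congr (_ * _).
rewrite -[level (invmx g)](level_iota _ kl); congr level.
apply: (can_inj (mulmxK giu)).
by rewrite mulVmx// -iota_mxM ?fs_dvd// mulVmx// iota_mx1 ?fs_dvd.
Qed.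

Lemma inner_dist_id k (g : 'M[F]_(n k)) x : g \in unitmx ->
  adist (inner g x) x <= 2 * rank_dist R g 1%:M.
Proof.
move=> gu; rewrite innerE// -level_isometry level1.
by apply: adist_conj_le; rewrite ?level_mulV ?level_Vmul.
Qed.

Section NearInner.
Context (phi : metric_aut M) (j : nat).
Local Notation m := (n j).

Let phiP : linear phi.
Proof. by have [_ h _ _] := metric_autP phi. Qed.

Let phi0 : phi 0 = 0.
Proof. by have := phiP (-1) 0 0; rewrite scaleN1r oppr0 addr0 scaleN1r addNr. Qed.

Let phi_dist x y : adist (phi x) (phi y) = adist x y.
Proof. by have [_ _ _ h] := metric_autP phi. Qed.

Let phiD : {morph phi : x y / x + y}.
Proof. by move=> x y; have := phiP 1 x y; rewrite !scale1r. Qed.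

Let phi_sum I (r : seq I) (f : I -> M) :
  phi (\sum_(i <- r) f i) = \sum_(i <- r) phi (f i).
Proof. by elim/big_rec2: _ => // i x y _ <-; rewrite phiD. Qed.

Let phiZ a x : phi (a *: x) = a *: phi x.
Proof. by have := phiP a x 0; rewrite phi0 !addr0. Qed.

Let o : 'I_m := Ordinal (fs_gt0 n j).
Let E a b : M := level (delta_mx a b : 'M_m).

Let EE a b c d : E a b * E c d = (E a d) *+ (b == c).
Proof.
rewrite /E -levelM mul_delta_mx_cond.
by case: eqP => _; rewrite ?mulr1n// mulr0n raddf0.
Qed.

Let sumE : \sum_a E a a = 1.
Proof.
rewrite -raddf_sum -(level1 j); congr level.
apply/matrixP => a b; rewrite summxE (bigD1 a)//= !mxE !eqxx big1 ?addr0 => [|c ca].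
  by rewrite eq_sym.
by rewrite mxE eq_sym (negPf ca).
Qed.

Let intertwine z (x : 'M[F]_m) :
  phi (level x) * intertwiner phi E o z = intertwiner phi E o z * level x.
Proof.
rewrite [x]matrix_sum_delta !raddf_sum phi_sum mulr_suml mulr_sumr.
apply: eq_bigr => a _; rewrite !raddf_sum phi_sum mulr_suml mulr_sumr.
apply: eq_bigr => b _; rewrite /= levelZ phiZ -scalerAl -scalerAr.
by rewrite intertwinerP.
Qed.

Lemma near_inner (e : R) : 0 < e -> exists k (g : 'M[F]_(n k)), g \in unitmx /\
  forall x : 'M[F]_m, adist (phi (level x)) (inner g (level x)) < e.
Proof.
move=> e0.
have sum3 (a b c d : R) : a < d -> b < d -> c <= m%:R * (2 * d) ->
    a + b + c < (2 * m%:R + 2) * d by lra.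
have sum2 (a b d : R) : a < (2 * m%:R + 2) * d -> b < d ->
    a + b < (2 * m%:R + 3) * d by lra.
(* The error budget: [2 d] for each of [m] diagonal terms, [2 d] for approximating [y] and [y'] by
   matrices, [d] more for passing from [Y] back to [y], all doubled by [adist_intertwine_le]. *)
pose d := e / (2 * (2 * m%:R + 3)).
have c0 : 0 < 2 * (2 * m%:R + 3) :> R.
  by rewrite mulr_gt0// ltr_wpDl// mulr_ge0.
have d0 : 0 < d by rewrite divr_gt0.
have [k0 [u0]] := level_dense (phi (E o o)) d0.
pose k := maxn k0 j; rewrite -(level_iota _ (leq_maxl k0 j)) -/k.
set P := iota_mx _ _ u0 => dP.
pose Q : 'M[F]_(n k) := iota_mx m _ (delta_mx o o).
have QE : level Q = E o o by rewrite level_iota// leq_maxr.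
have [Z' [Z hZ]] := rank_compress P Q.
have nk0 : 0 < (n k)%:R :> R by rewrite ltr0n fs_gt0.
have rankE (X : 'M[F]_(n k)) : (\rank X)%:R = adist (level X : M) 0 * (n k)%:R.
  by rewrite -(level0 k) level_isometry /rank_dist subr0 divfK ?gt_eqF.
(* Normalized rank is distance to 0, so the isometry [phi] preserves that of [E o o], and [level P]
   is within [d] of [phi (E o o)]. *)
have rPQ : `|(\rank P)%:R - (\rank Q)%:R| <= d * (n k)%:R.
  rewrite !rankE QE -(phi_dist (E o o)) phi0 -mulrBl normrM.
  rewrite [X in _ * X]ger0_norm// ler_pM2r//.
  by apply: le_trans (adist_lip _ _ _) _; rewrite adist_sym; exact: ltW dP.
pose z : M := level Z; pose z' : M := level Z'.
have zE : adist (z' * level P * z) (E o o) <= d.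
  rewrite -QE -!levelM level_isometry /rank_dist ler_pdivrMr//.
  apply: le_trans rPQ; move: hZ; rewrite -(ler_nat R) => /le_trans; apply.
  have [pq|/ltnW qp] := leqP (\rank P) (\rank Q).
  - by rewrite (eqP pq) add0n natrB// distrC ler_norm.
  - by rewrite (eqP qp) addn0 natrB// ler_norm.
have Eoo : E o o * E o o = E o o by rewrite EE eqxx.
have cE := adist_idem_le (level P) (phi (E o o)) z' z Eoo.
have y'y := cointertwiner_mul phi o EE sumE z' z.
set y' := cointertwiner _ _ _ _ in y'y; set y := intertwiner _ _ _ _ in y'y.
have [l1 [v1 dv1]] := level_dense y d0.
have [l2 [v2 dv2]] := level_dense y' d0.
(* At a common level, [Y' *m Y] is close to 1, hence some invertible [g] is close to [Y]. *)
pose l := maxn l1 l2.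
rewrite -(level_iota _ (leq_maxl l1 l2)) -/l in dv1.
rewrite -(level_iota _ (leq_maxr l1 l2)) -/l in dv2.
set Y := iota_mx _ _ v1 in dv1; set Y' := iota_mx _ _ v2 in dv2.
have [g gu gY] := near_unitmx_of_mul Y' Y; exists l, g; split=> // x.
have YY : adist (level Y' * level Y) 1 < (2 * m%:R + 2) * d.
  have h1 := adist_mul1_le y' y (level Y') (level Y).
  have h2 : adist (y' * y) 1 <= m%:R * (2 * d).
    apply: le_trans y'y _; rewrite ler_wpM2l//; apply: le_trans cE _.
    by rewrite (_ : 2 * d = d + d); [exact: lerD (ltW dP) zE | ring].
  exact: le_lt_trans h1 (sum3 _ _ _ _ dv2 dv1 h2).
have gYd : adist (level g) (level Y) <= adist (level Y' * level Y) 1.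
  rewrite -levelM -(level1 l) !level_isometry /rank_dist.
  by rewrite ler_wpM2r ?invr_ge0// ler_nat.
have h1 := adist_intertwine_le (level_mulV gu) (level_Vmul gu) (intertwine z x).
rewrite innerE//; apply: le_lt_trans h1 _; rewrite -/y.
have -> : e = 2 * ((2 * m%:R + 3) * d).
  by rewrite /d; field; rewrite gt_eqF// ltr_wpDl// mulr_ge0.
rewrite ltr_pM2l//; apply: le_lt_trans (adist_triangle (level Y) _ _) _.
rewrite [adist (level Y) y]adist_sym.
exact: sum2 _ _ _ (le_lt_trans gYd YY) dv1.
Qed.

End NearInner.

Lemma inner_dense :
  dense [set f : metric_aut M |
    exists k (g : 'M[F]_(n k)), g \in unitmx /\ f = inner g]%classic.
Proof.
move=> O [phi Ophi] oO.
have [X [e [e0 XO]]] : nbhs phi O by exact: open_nbhs_nbhs.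
have e3 : 0 < e / 3 by rewrite divr_gt0.
(* One level approximates all points of the finite set [X], because each level contains the earlier
   ones. *)
have [j Xj] : exists j, forall x, x \in X ->
    exists u : 'M[F]_(n j), adist x (level u) < e / 3.
  elim: {XO} X => [|x X [j Xj]]; first by exists 0%N.
  have [k [u xu]] := level_dense x e3; exists (maxn j k) => x'.
  rewrite inE => /orP[/eqP ->|/Xj[v xv]].
  - by exists (iota_mx _ _ u); rewrite level_iota ?leq_maxr.
  - by exists (iota_mx _ _ v); rewrite level_iota ?leq_maxl.
have [k [g [gu hg]]] := near_inner phi j e3.
exists (inner g); split; last by exists k, g.
apply: XO => x /Xj[u xu].
have [_ _ _ phi_dist] := metric_autP phi.
have [_ _ _ g_dist] := metric_autP (inner g).
apply: le_lt_trans (adist_triangle (inner g (level u)) _ _) _.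
rewrite g_dist (_ : e = e / 3 + (e / 3 + e / 3)); last by field.
apply: ltrD; first exact: xu.
apply: le_lt_trans (adist_triangle (phi (level u)) _ _) _.
rewrite phi_dist adist_sym [adist (level u) x]adist_sym.
by apply: ltrD; [exact: hg|exact: xu].
Qed.

End Levels.

(** * From concentration to extreme amenability *)

Lemma fs_unbounded (n : factor_sequence) N :
  exists l0, forall l, (l0 <= l)%N -> (N <= n l)%N.
Proof.
have [l0 _ nl0] := @fs_cvg n _ (nbhs_infty_ge N).
by exists l0 => l l0l; exact: nl0.
Qed.

Lemma pigeonhole_cover (T I : finType) (S : {set T}) (B : I -> {set T}) :
  (0 < #|S|)%N -> (forall x, x \in S -> exists i, x \in B i) ->
  exists i, (#|S| <= #|I| * #|B i|)%N.
Proof.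
move=> /card_gt0P[x0 x0S] SB; have [i0 _] := SB _ x0S.
have I0 : (0 < #|I|)%N by apply/card_gt0P; exists i0.
have [i iE] := bigop.eq_bigmax (fun i => #|B i|) I0; exists i.
rewrite -iE -sum_nat_const.
apply: (@leq_trans (\sum_i #|B i|)); last by apply: leq_sum => j _; exact: leq_bigmax.
apply: (@leq_trans #|(\bigcup_i B i)%SET|).
  by apply/subset_leq_card/fintype.subsetP => x /SB[j xj]; apply/finset.bigcupP; exists j.
elim/big_rec2: _ => [|j s C _ Cs]; first by rewrite cards0.
by rewrite (leq_trans (leq_card_setU _ _))// leq_add2l.
Qed.

Theorem mainTheorem4 (F : finFieldType) (R : realType) (n : factor_sequence) :
  extremely_amenable (metric_aut (rank_completion F R n)).
Proof.
apply: extremely_amenable_finite_cover (@inner_dense F R n) _.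
move=> W I A h [X [e [e0 XW]]] cover hD.
have /choice[p pP] i : exists p : {k : nat & 'M[F]_(n k)},
    tagged p \in unitmx /\ h i = inner (tagged p).
  by have [k [g gP]] := hD i; exists (Tagged (fun k => 'M[F]_(n k)) g).
pose k i := tag (p i).
(* Conjugation by [w] moves points by at most twice the distance from [w] to 1, here
   [2 * e4 < e]. *)
pose e4 := e / 4; have e40 : 0 < e4 by rewrite divr_gt0.
have [N0 nN0] := fs_unbounded n (Num.truncn ((16 * #|I|)%:R / e4 ^+ 2)).+1.
(* Level [K] contains the matrices of all the [h i] and is large enough for concentration with
   proportion 1/#|I|. *)
pose K := maxn N0 (\max_i k i).
have kK i : (k i <= K)%N by rewrite leq_max (leq_bigmax i) orbT.
have nK : (16 * #|I|)%:R < e4 ^+ 2 * (n K)%:R.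
  rewrite mulrC -ltr_pdivrMr ?exprn_gt0// (lt_le_trans (truncnS_gt _))//.
  by rewrite ler_nat; apply/nN0/leq_maxl.
pose U : {set 'M[F]_(n K)} := [set C | C \in unitmx].
pose B i : {set 'M[F]_(n K)} := [set C | (C \in unitmx) && `[< A i (inner C) >]].
have BU i : B i \subset unitmx.
  by apply/fintype.subsetP => C; rewrite inE => /andP[].
have [||i UB] := @pigeonhole_cover _ _ U B.
- by apply/card_gt0P; exists 1%:M; rewrite inE unitmx1.
- move=> C; rewrite inE => Cu; have [i Ai] := cover (inner C).
  by exists i; rewrite inE Cu; apply/asboolP.
have [gu hg] := pP i; pose G := iota_mx _ (n K) (tagged (p i)).
have Gu : G \in unitmx by apply: iota_mx_unit gu; exact: fs_dvd (kK i).
have hG : h i = inner G by rewrite hg (inner_iota (kK i)).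
(* The translate has as many elements as [B i], so concentration yields [C] in [B i] close to some
   [G *m C'] with [C'] in [B i]. *)
pose GB := [set G *m C | C in B i].
have [||C [D [CB /imsetP[C' C'B ->] CC']]] :=
    unitmx_concentration (B := GB) (BU i) _ UB _ e40 nK.
- apply/fintype.subsetP => D /imsetP[C CB ->]; rewrite unitmx_mul Gu.
  exact: (fintype.subsetP (BU i)).
- by rewrite card_imset//; exact: can_inj (mulKmx Gu).
move: CB C'B; rewrite !inE => /andP[Cu /asboolP AC] /andP[C'u /asboolP AC'].
(* This choice gives [w *m C = G *m C'], and [w] is as close to 1 as [G *m C'] is to [C]. *)
pose w := G *m C' *m invmx C.
have wu : w \in unitmx by rewrite !unitmx_mul Gu C'u unitmx_inv.
exists i, (inner C'), (inner C), (inner w); split=> //; last first.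
  by rewrite hG -!innerM// mulmxKV.
apply: XW => x _; apply: le_lt_trans (inner_dist_id x wu) _.
have nK0 : 0 < (n K)%:R :> R by rewrite ltr0n fs_gt0.
apply: (@le_lt_trans _ _ (2 * e4)); last by rewrite /e4; lra.
rewrite ler_pM2l// /rank_dist ler_pdivrMr//; apply: le_trans CC'; rewrite ler_nat.
have -> : w - 1%:M = - ((C - G *m C') *m invmx C).
  by rewrite mulmxBl mulmxV// opprB.
by rewrite mxrank_opp mxrankM_maxl.
Qed.
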